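(* Let $\alpha\in(1,2)$, let $p\ge2$ and $n\ge1$ be integers. Then $T_n^{p,\alpha}=T_{n+p-2}(f^{p,\alpha})$, i.e. for every integer $k$ the number $t_k=\frac{1}{2\cos(\pi\alpha/2)}\left(D^{\alpha}_{-\infty,x}\phi_p\!\left(\tfrac{p+1}{2}-k\right)+D^{\alpha}_{x,+\infty}\phi_p\!\left(\tfrac{p+1}{2}-k\right)\right)$ equals the $k$-th Fourier coefficient $\frac{1}{2\pi}\int_{-\pi}^{\pi}f^{p,\alpha}(\theta)e^{-\mathrm{i}k\theta}\,d\theta$ of $$f^{p,\alpha}(\theta)=\sum_{l\in\mathbb Z}|\theta+2l\pi|^{\alpha}\left(\frac{\sin(\theta/2+l\pi)}{\theta/2+l\pi}\right)^{p+1}.$$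
   Context: The cardinal B-spline $\phi_p$ is defined by $\phi_0=\mathbf 1_{[0,1)}$ and $\phi_p(t)=\frac{t}{p}\phi_{p-1}(t)+\frac{p+1-t}{p}\phi_{p-1}(t-1)$ for $p\ge1$; it is supported on $[0,p+1]$. For compactly supported $u$ with absolutely continuous $(m-1)$-th derivative, $m-1\le\alpha<m$ integer, $D^{\alpha}_{-\infty,x}u(x)=\frac{1}{\Gamma(m-\alpha)}\frac{d^m}{dx^m}\int_{-\infty}^x (x-y)^{m-\alpha-1}u(y)\,dy$ and $D^{\alpha}_{x,+\infty}u(x)=\frac{(-1)^m}{\Gamma(m-\alpha)}\frac{d^m}{dx^m}\int_x^{+\infty}(y-x)^{m-\alpha-1}u(y)\,dy$. For $f\in L^1([-\pi,\pi])$ with Fourier coefficients $f_k=\frac1{2\pi}\int_{-\pi}^{\pi}f(\theta)e^{-\mathrm{i}k\theta}d\theta$, $T_N(f)$ is the $N\times N$ Toeplitz matrix with $(i,j)$ entry $f_{i-j}$. $T_n^{p,\alpha}$ is the $(n+p-2)\times(n+p-2)$ matrix with $(i,j)$ entry $t_{i-j}$, with $t_k$ as in the claim (equivalently, $T_n^{p,\alpha}=\frac{1}{2\cos(\pi\alpha/2)}(T^L+T^R)$ where $T^L_{ij}=D^{\alpha}_{-\infty,x}\phi_p(\frac{p+1}{2}+i-j)$ and $T^R_{ij}=D^{\alpha}_{x,+\infty}\phi_p(\frac{p+1}{2}+i-j)$). *)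

(* Defs.v *)
From HB Require Import structures.
From mathcomp Require Import all_boot all_order all_algebra.
From mathcomp Require Import all_classical all_reals all_analysis.
From mathcomp Require Import complex.

Set Implicit Arguments.
Unset Strict Implicit.
Unset Printing Implicit Defensive.
Import Order.TTheory GRing.Theory Num.Theory.
Import numFieldNormedType.Exports.
Local Open Scope classical_set_scope.
Local Open Scope ring_scope.

Section Defs.
Variable R : realType.

Fixpoint bspline (p : nat) (t : R) : R :=
  match p with
  | 0 => if (0 <= t) && (t < 1) then 1 else 0
  | p'.+1 => t / p'.+1%:R * bspline p' t
             + (p'.+2%:R - t) / p'.+1%:R * bspline p' (t - 1)
  end.

Definition Gamma (s : R) : R :=
  \int[@lebesgue_measure R]_(t in `]0, +oo[) (t `^ (s - 1) * expR (- t)).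

(* Left Riemann--Liouville fractional derivative of order alpha, with
   integer m, m - 1 <= alpha < m:
   D^alpha_{-oo,x} u(x) = 1/Gamma(m-alpha) d^m/dx^m int_{-oo}^x (x-y)^(m-alpha-1) u(y) dy *)
Definition RL_left (m : nat) (alpha : R) (u : R -> R) : R -> R :=
  derive1n m (fun x : R =>
    \int[@lebesgue_measure R]_(y in `]-oo, x[) ((x - y) `^ (m%:R - alpha - 1) * u y))
  \* cst (Gamma (m%:R - alpha))^-1.

Definition RL_right (m : nat) (alpha : R) (u : R -> R) : R -> R :=
  derive1n m (fun x : R =>
    \int[@lebesgue_measure R]_(y in `]x, +oo[) ((y - x) `^ (m%:R - alpha - 1) * u y))
  \* cst ((-1) ^+ m / Gamma (m%:R - alpha)).

(* t_k for alpha in (1,2) (so m = 2). *)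
Definition tcoef (p : nat) (alpha : R) (k : int) : R :=
  (2 * cos (pi * alpha / 2))^-1 *
  (RL_left 2 alpha (bspline p) ((p.+1)%:R / 2 - k%:~R)
   + RL_right 2 alpha (bspline p) ((p.+1)%:R / 2 - k%:~R)).

Definition Tnpa (n p : nat) (alpha : R) : 'M[R]_(n + p - 2) :=
  \matrix_(i, j) tcoef p alpha (i%:Z - j%:Z).

Definition fterm (p : nat) (alpha : R) (theta : R) (l : int) : R :=
  `|theta + 2 * l%:~R * pi| `^ alpha *
  (sin (theta / 2 + l%:~R * pi) / (theta / 2 + l%:~R * pi)) ^+ p.+1.

(* f^{p,alpha}(theta) = sum_{l in Z} fterm l, the bilateral (absolutely
   convergent) series summed as sum_{l>=0} (fterm l + fterm (-l-1)). *)
Definition fpa (p : nat) (alpha : R) (theta : R) : R :=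
  limn (fun N : nat =>
    \sum_(0 <= l < N) (fterm p alpha theta l%:Z + fterm p alpha theta (- (l%:Z) - 1))).

Definition fourier_coef (f : R -> R) (k : int) : R[i] :=
  Complex
    ((2 * pi)^-1 * \int[@lebesgue_measure R]_(x in `[- pi, pi]) (f x * cos (k%:~R * x)))
    (- ((2 * pi)^-1 * \int[@lebesgue_measure R]_(x in `[- pi, pi]) (f x * sin (k%:~R * x)))).

Definition toeplitz (N : nat) (f : R -> R) : 'M[R[i]]_N :=
  \matrix_(i, j) fourier_coef f (i%:Z - j%:Z).

End Defs.

(* Main.v *)
(* Put b = 2 - alpha, and let D g (x) = g x - g (x - 1).  The spline bspline q is
   D^(q+1) applied to the truncated power x_+^q / q!, whose fractional integral of
   order b is a multiple of x_+^(q+b).  As bspline p is symmetric about (p+1)/2,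
   the sum of the two fractional derivatives is D^(p+1) of a multiple of
   x_+^(p-alpha) + (-1)^(p+1) (-x)_+^(p-alpha).  For p = 2 this function is
   |x|^b sgn x, a multiple of the integral over ]0, +oo[ of
   theta^(-b-1) sin (theta x) = theta^(alpha-3) sin (theta x); applying D^3 and then
   integrating over [x - 1, x] to pass from p to p + 1, the sum becomes a multiple of
   the integral over ]0, +oo[ of
   theta^alpha (sin (theta/2) / (theta/2))^(p+1) cos (theta (x - (p+1)/2)).
   The Fourier coefficient of f^{p,alpha} unfolds to the same integral by dominated
   convergence.  The constants match because
   Gamma(b+1) int_0^oo t^(-b-1) sin t dt = int_0^oo u^b / (1+u^2) du
   = pi / (2 cos (pi b/2)).  The last value comes without complex analysis: the
   recurrences in n of int_0^oo u^(b-1) (u/(1+u^2))^n du and of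
   int_0^(pi/2) cos (b x) cos^n x dx mirror each other, and both are asymptotic to
   their values at b = 0. *)
Require Import Defs.
From HB Require Import structures.
From mathcomp Require Import all_boot all_order all_algebra.
From mathcomp Require Import all_classical all_reals all_analysis.
From mathcomp Require Import measurable_realfun complex ring lra.

Set Implicit Arguments.
Unset Strict Implicit.
Unset Printing Implicit Defensive.
Import Order.TTheory GRing.Theory Num.Theory.
Import numFieldNormedType.Exports.
Local Open Scope classical_set_scope.
Local Open Scope ring_scope.

(** * Calculus on the real line *)

(** All integrals are Lebesgue integrals, so every representation must converge absolutely, and this
    shapes the proof. The function theta^(-b-1) sin (theta x) is integrable at 0 because b < 1 and
    at infinity because b > 0. For p > 2 the analogous formula for the undifferenced power would
    carry theta^(-b-1-(p-2)) times a sine or cosine, which diverges at 0 unless Taylor terms are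
    subtracted. Hence the induction on p runs on differenced functions only: integrating over
    [x - 1, x] is convolution with the indicator of [0, 1[, which contributes one more factor sin
    (theta/2) / (theta/2) and moves the centre by 1/2.

    In the evaluation of the constant, u = exp v turns the first family of moments into integrals of
    exp (b v) / (2 cosh v)^n, the hyperbolic counterpart of cos (b x) cos^n x. The factors N^2 - b^2
    multiply in one recurrence and divide in the other; running both to infinity amounts to Euler's
    product of 1 - b^2/(2k+1)^2 for cos (pi b/2). Only ratios to the values at b = 0 occur, so the
    growth of neither family has to be known. *)

Section real_derivatives.
Context {R : realType}.
Implicit Types (f g : R -> R) (x a b k : R).

Lemma deriv_cst x k : is_derive x 1 (fun _ : R => k) 0.
Proof. exact: is_derive_cst. Qed.

Lemma deriv_id x : is_derive x 1 (fun y : R => y) 1.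
Proof. exact: is_derive_id. Qed.

Lemma derivD f g x a b : is_derive x 1 f a -> is_derive x 1 g b ->
  is_derive x 1 (fun y => f y + g y) (a + b).
Proof. exact: is_deriveD. Qed.

Lemma derivN f x a : is_derive x 1 f a -> is_derive x 1 (fun y => - f y) (- a).
Proof. exact: is_deriveN. Qed.

Lemma derivM f g x a b : is_derive x 1 f a -> is_derive x 1 g b ->
  is_derive x 1 (fun y => f y * g y) (f x * b + g x * a).
Proof. exact: is_deriveM. Qed.

Lemma deriv_comp f g x a b : is_derive (g x) 1 f a -> is_derive x 1 g b ->
  is_derive x 1 (fun y => f (g y)) (a * b).
Proof. exact: is_derive1_comp. Qed.

Lemma derivX f n x a : is_derive x 1 f a ->
  is_derive x 1 (fun y => f y ^+ n) (n%:R * f x ^+ n.-1 * a).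
Proof.
move=> df; have -> : (fun y => f y ^+ n) = f ^+ n by apply/funext => y; rewrite fctE.
exact: is_deriveX.
Qed.

Lemma derivV f x a : f x != 0 -> is_derive x 1 f a ->
  is_derive x 1 (fun y => (f y)^-1) (- a / f x ^+ 2).
Proof.
move=> fx0 [df fa]; apply: DeriveDef; first exact: derivableV.
by rewrite deriveV// fa /GRing.scale/= mulNr mulNr mulrC.
Qed.

Lemma deriv_powR f x a p : 0 < f x -> is_derive x 1 f a ->
  is_derive x 1 (fun y => f y `^ p) (p * f x `^ (p - 1) * a).
Proof. by move=> fx0; apply: (@deriv_comp (fun y => y `^ p)); exact: is_derive1_powR. Qed.

Lemma deriv_expR f x a : is_derive x 1 f a ->
  is_derive x 1 (fun y => expR (f y)) (expR (f x) * a).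
Proof. exact: deriv_comp. Qed.

Lemma deriv_sin f x a : is_derive x 1 f a ->
  is_derive x 1 (fun y => sin (f y)) (cos (f x) * a).
Proof. exact: deriv_comp. Qed.

Lemma deriv_cos f x a : is_derive x 1 f a ->
  is_derive x 1 (fun y => cos (f y)) (- sin (f x) * a).
Proof. exact: deriv_comp. Qed.

Lemma is_derive_continuous f x a : is_derive x 1 f a -> {for x, continuous f}.
Proof.
by move=> [df _]; apply: differentiable_continuous; exact/derivable1_diffP.
Qed.

End real_derivatives.

(* [is_derive] is a class: instance search and blind unification would unfold
   the power series defining the transcendental functions, hence the dispatch on
   the head symbol and [notypeclasses refine]. *)
Ltac deriv1 := lazymatch goal with
  | |- is_derive _ _ (fun _ => ?k) _ => notypeclasses refine (deriv_cst _ _)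
  | |- is_derive _ _ (fun y => y) _ => notypeclasses refine (deriv_id _)
  | |- is_derive _ _ (fun y => (@?f y + @?g y)%R) _ => notypeclasses refine (@derivD _ f g _ _ _ _ _)
  | |- is_derive _ _ (fun y => (- @?f y)%R) _ => notypeclasses refine (@derivN _ f _ _ _)
  | |- is_derive _ _ (fun y => (@?f y * @?g y)%R) _ => notypeclasses refine (@derivM _ f g _ _ _ _ _)
  | |- is_derive _ _ (fun y => ((@?f y) ^+ ?n)%R) _ => notypeclasses refine (@derivX _ f n _ _ _)
  | |- is_derive _ _ (fun y => ((@?f y)^-1)%R) _ => notypeclasses refine (@derivV _ f _ _ _ _)
  | |- is_derive _ _ (fun y => powR (@?f y) ?p) _ => notypeclasses refine (@deriv_powR _ f _ _ p _ _)
  | |- is_derive _ _ (fun y => expR (@?f y)) _ => notypeclasses refine (@deriv_expR _ f _ _ _)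
  | |- is_derive _ _ (fun y => sin (@?f y)) _ => notypeclasses refine (@deriv_sin _ f _ _ _)
  | |- is_derive _ _ (fun y => cos (@?f y)) _ => notypeclasses refine (@deriv_cos _ f _ _ _)
  end.
Ltac deriv := repeat deriv1.
Ltac apply_is_derive := notypeclasses refine (is_derive_eq _ _).
Ltac apply_continuous := notypeclasses refine (is_derive_continuous _).

(** * The fundamental theorem of calculus for proper and improper integrals *)

Section fundamental_theorem.
Context {R : realType}.
Local Notation mu := (@lebesgue_measure R).
Local Notation Rintegrable D f := (mu.-integrable D (EFin \o f)).
Implicit Types (D : set R) (f g F : R -> R).

Lemma cvg_Rintegral_exhaust D (E : nat -> set R) f :
  measurable D -> (forall n, measurable (E n)) -> (forall n, E n `<=` D) ->
  (forall x : R, D x -> \forall n \near \oo, E n x) -> Rintegrable D f ->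
  \int[mu]_(x in E n) f x @[n --> \oo] --> \int[mu]_(x in D) f x.
Proof.
move=> mD mE ED nE intf.
have mf : measurable_fun D f by apply/measurable_EFinP; exact: measurable_int intf.
pose f_ n x : \bar R := ((f \_ (E n)) x)%:E.
have [] := @dominated_convergence _ _ R mu D mD f_ (EFin \o f) (EFin \o (fun x => `|f x|)).
- move=> n; apply/measurable_EFinP; apply/measurable_restrict => //.
    exact: mE.
  by apply: (measurable_funS mD _ mf) => x [].
- by apply/measurable_EFinP.
- apply: aeW => x Dx; apply: cvg_near_cst.
  by near=> n; rewrite /f_ patchE mem_set//; near: n; exact: nE.
- exact: integrable_norm.
- apply: aeW => x n Dx; rewrite /f_ /= lee_fin patchE.
  by case: ifPn => //; rewrite normr0.
move=> _ _ cv.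
have H n : \int[mu]_(x in E n) f x = fine (\int[mu]_(x in D) f_ n x).
  by rewrite -{1}(setIidr (ED n)) Rintegral_mkcondr.
under eq_cvg do rewrite H.
apply: fine_cvg; rewrite /Rintegral fineK//.
exact: integrable_fin_num.
Unshelve. all: by end_near. Qed.

Lemma Rintegral_FTC f F (a b : R) : a <= b ->
  (forall x : R, a <= x <= b -> {for x, continuous f}) ->
  (forall x : R, a <= x <= b -> is_derive x 1 F (f x)) ->
  \int[mu]_(x in `[a, b]) f x = F b - F a.
Proof.
rewrite le_eqVlt => /predU1P[<- _ _|ab cf dF].
  by rewrite set_itv1 Rintegral_set1 subrr.
rewrite /Rintegral (@continuous_FTC2 _ f F a b)//.
- apply: continuous_in_subspaceT => x; rewrite inE/= in_itv/=; exact: cf.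
- have cF x : a <= x <= b -> {for x, continuous F}.
    move=> xab; apply: differentiable_continuous; apply/derivable1_diffP.
    by have [] := dF _ xab.
  split.
  + move=> x; rewrite in_itv/= => /andP[ax xb].
    by have [] := dF x; rewrite ?(ltW ax) ?(ltW xb).
  + by apply: cvg_at_right_filter; apply: cF; rewrite lexx ltW.
  + by apply: cvg_at_left_filter; apply: cF; rewrite lexx ltW.
- move=> x; rewrite in_itv/= => /andP[ax xb].
  have [] := dF x; rewrite ?(ltW ax) ?(ltW xb)// => _.
  by rewrite derive1E.
Qed.

Lemma Rintegral_FTC_exhaust D f F (a b : nat -> R) (la lb : R) : measurable D ->
  (forall n, a n <= b n) -> (forall n, `[a n, b n] `<=` D) ->
  (forall x : R, D x -> \forall n \near \oo, a n <= x <= b n) ->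
  (forall x : R, D x -> {for x, continuous f}) ->
  (forall x : R, D x -> is_derive x 1 F (f x)) ->
  F (a n) @[n --> \oo] --> la -> F (b n) @[n --> \oo] --> lb ->
  Rintegrable D f -> \int[mu]_(x in D) f x = lb - la.
Proof.
move=> mD ab abD nab cf dF Fa Fb intf.
have H : \int[mu]_(x in `[a n, b n]) f x @[n --> \oo] --> \int[mu]_(x in D) f x.
  apply: (@cvg_Rintegral_exhaust D (fun n => `[a n, b n]%classic)) => //.
rewrite -(cvg_lim _ H)//; apply/cvg_lim => //.
have -> : (fun n => \int[mu]_(x in `[a n, b n]) f x) = (fun n => F (b n) - F (a n)).
  apply/funext => n; apply: Rintegral_FTC => // x xab.
  - by apply/cf/(abD n); rewrite /= in_itv.
  - by apply/dF/(abD n); rewrite /= in_itv.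
exact: cvgB.
Unshelve. all: by end_near. Qed.

Lemma Rintegral_FTC0y f F (la lb : R) :
  (forall x : R, 0 < x -> {for x, continuous f}) ->
  (forall x : R, 0 < x -> is_derive x 1 F (f x)) ->
  F x @[x --> 0^'+] --> la -> F x @[x --> +oo] --> lb ->
  Rintegrable `]0, +oo[ f -> \int[mu]_(x in `]0, +oo[) f x = lb - la.
Proof.
move=> cf dF Fa Fb intf.
apply: (@Rintegral_FTC_exhaust _ f F (fun n => n.+1%:R^-1) (fun n => n.+1%:R)) => //.
- move=> n; rewrite (@le_trans _ _ 1)// ?ler1n// invf_le1// ?ler1n// ltr0n//.
- move=> n x /=; rewrite !in_itv/= andbT => /andP[+ _]; apply: lt_le_trans.
  by rewrite invr_gt0.
- move=> x /=; rewrite in_itv/= andbT => x0; near=> n; apply/andP; split.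
    rewrite -[leRHS]invrK lef_pV2 ?posrE ?invr_gt0// (@le_trans _ _ n%:R)//.
      by near: n; exact: nbhs_infty_ger.
    by rewrite ler_nat.
  rewrite (@le_trans _ _ n%:R)//; first by near: n; exact: nbhs_infty_ger.
  by rewrite ler_nat.
- by move=> x /=; rewrite in_itv/= andbT; exact: cf.
- by move=> x /=; rewrite in_itv/= andbT; exact: dF.
- move/cvg_at_rightP : Fa; apply; split; last exact: cvg_harmonic.
  by move=> n; rewrite invr_gt0.
- move/cvg_pinftyP : Fb; apply; apply/cvgryPge => r; near=> n.
  rewrite (@le_trans _ _ n%:R)//; first by near: n; exact: nbhs_infty_ger.
  by rewrite ler_nat.
Unshelve. all: by end_near. Qed.

Lemma Rintegral_FTC0o f F (c la lb : R) : 0 < c ->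
  (forall x : R, 0 < x < c -> {for x, continuous f}) ->
  (forall x : R, 0 < x < c -> is_derive x 1 F (f x)) ->
  F x @[x --> 0^'+] --> la -> F x @[x --> c^'-] --> lb ->
  Rintegrable `]0, c[ f -> \int[mu]_(x in `]0, c[) f x = lb - la.
Proof.
move=> c0 cf dF Fa Fb intf.
(* Dividing by [n.+2] keeps the left endpoint at most [c / 2], so the exhausting intervals are never
   reversed. *)
have h n : 0 < c * n.+2%:R^-1 <= c / 2.
  rewrite mulr_gt0 ?invr_gt0//= ler_pM2l// lef_pV2 ?posrE//.
  by rewrite ler_nat.
have h0 : c * n.+2%:R^-1 @[n --> \oo] --> (0 : R).
  rewrite -[X in _ --> X](mulr0 c); apply: cvgMr.
  have := @cvg_harmonic R; rewrite -cvg_shiftS; exact.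
apply: (@Rintegral_FTC_exhaust _ f F (fun n => c * n.+2%:R^-1) (fun n => c - c * n.+2%:R^-1)) => //.
- by move=> n; have := h n; set t := c * _ => /andP[h1 h2]; lra.
- move=> n x /=; rewrite !in_itv/=; have := h n; set t := c * _ => /andP[h1 h2] /andP[x1 x2]; apply/andP; split; lra.
- move=> x /=; rewrite in_itv/= => /andP[x0 xc]; have mn : 0 < Num.min x (c - x) by rewrite lt_min x0 subr_gt0 xc.
  near=> n; have : c * n.+2%:R^-1 < Num.min x (c - x).
    near: n; exact: (cvgr_lt _ h0).
  by rewrite lt_min; set t := c * _ => /andP[x1 x2]; apply/andP; split; lra.
- move/cvg_at_rightP : Fa; apply; split; last exact: h0.
  by move=> n; have /andP[] := h n.
- move/cvg_at_leftP : Fb; apply; split.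
    by move=> n; have := h n; set t := c * _ => /andP[h1 h2]; lra.
  by rewrite -[X in _ --> X]subr0; apply: cvgB => //; exact: cvg_cst.
Unshelve. all: by end_near. Qed.

End fundamental_theorem.

(** * Integrability from power bounds at 0 and at infinity *)

Section integrability_test.
Context {R : realType}.
Local Notation mu := (@lebesgue_measure R).
Local Notation Rintegrable D f := (mu.-integrable D (EFin \o f)).
Implicit Types (D : set R) (f g F : R -> R).

Lemma powR_cvgy (m : R) : 0 < m -> x `^ m @[x --> +oo] --> +oo.
Proof.
move=> m0; apply/cvgryPge => A; near=> x.
have A1 : 0 <= Num.max A 1 by rewrite le_max ler01 orbT.
rewrite (@le_trans _ _ (Num.max A 1))//; first by rewrite le_max lexx.
rewrite -[leLHS]powRr1// -(@mulVf _ m) ?gt_eqF// powRrM ge0_ler_powR ?nnegrE ?powR_ge0 ?(ltW m0)//.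
Unshelve. all: by end_near. Qed.

Lemma powR_cvgy0 (m : R) : 0 < m -> (1 + x `^ m)^-1 @[x --> +oo] --> (0 : R).
Proof.
move=> m0; apply/gtr0_cvgV0; first by apply: nearW => x; rewrite ltr_pwDl ?powR_ge0.
apply: ger_cvgy; last exact: powR_cvgy m0.
by apply: nearW => x; rewrite lerDr.
Qed.

(** One elementary majorant serves both ends: [g] behaves like x^(m-1) at 0 and like x^(-m-1) at
    infinity, and it is the derivative of - 1 / (m (1 + x^m)). Its integrals over [1/(n+1), +oo[ are
    therefore at most 1/m, and monotone convergence makes it integrable. The constant 4 bounds (1 +
    x^m)^2 by 4 for x <= 1 and by 4 x^(2m) for x >= 1. *)
Lemma Rintegrable_powR_test f (m C : R) : 0 < m ->
  measurable_fun (`]0, +oo[%classic : set R) f ->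
  (forall x : R, 0 < x -> x <= 1 -> `|f x| <= C * x `^ (m - 1)) ->
  (forall x, 1 <= x -> `|f x| <= C * x `^ (- m - 1)) ->
  Rintegrable `]0, +oo[ f.
Proof.
move=> m0 mf f01 f1y.
pose g x : R := x `^ (m - 1) / (1 + x `^ m) ^+ 2.
pose G x : R := - m^-1 * (1 + x `^ m)^-1.
have dG (x : R) : 0 < x -> is_derive x 1 G (g x).
  move=> x0; have xm : 1 + x `^ m != 0 by rewrite gt_eqF// ltr_pwDl// powR_ge0.
  rewrite /G; apply_is_derive; first by deriv.
  rewrite /g; field; rewrite xm gt_eqF//.
have g0 (x : R) : 0 <= g x.
  by rewrite /g divr_ge0 ?exprn_ge0 ?powR_ge0// addr_ge0 ?powR_ge0.
have Gy : G x @[x --> +oo] --> (0 : R).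
  rewrite /G -[X in _ --> X](mulr0 (- m^-1)); apply: cvgMr; exact: powR_cvgy0.
have cg (x : R) : 0 < x -> {for x, continuous g}.
  move=> x0; have xm : 1 + x `^ m != 0 by rewrite gt_eqF// ltr_pwDl// powR_ge0.
  rewrite /g; apply_continuous; by deriv => //; rewrite ?expf_neq0.
have ig (a : R) : 0 < a -> (\int[mu]_(x in `[a, +oo[) (g x)%:E = (0 - G a)%:E)%E.
  move=> a0; rewrite (@ge0_continuous_FTC2y _ g G a 0)//.
  - apply: continuous_in_subspaceT => x; rewrite inE/= in_itv/= andbT => ax.
    by apply: cg; lra.
  - by move=> x ax; have [] := dG x (lt_trans a0 ax).
  - by apply: cvg_at_right_filter; apply: is_derive_continuous; apply: dG.
  - move=> x; rewrite in_itv/= andbT => ax.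
    by rewrite derive1E; have [_ ->] := dG x (lt_trans a0 ax).
have mg : measurable_fun (`]0, +oo[%classic : set R) g.
  apply: open_continuous_measurable_fun => // x.
  by rewrite inE/= in_itv/= andbT; exact: cg.
have Ig : Rintegrable `]0, +oo[ g.
  apply/integrableP; split; first exact/measurable_EFinP.
  pose F n : set R := `[(n.+1%:R^-1 : R), +oo[%classic.
  have UF : \bigcup_n F n = `]0, +oo[%classic.
    apply/seteqP; split => [x [n _] /=|x /=].
      by rewrite /F/= !in_itv/= !andbT; apply: lt_le_trans; rewrite invr_gt0.
    rewrite in_itv/= andbT => x0; have [n _ nx] := @nbhs_infty_ger R x^-1.
    exists n => //; rewrite /F/= in_itv/= andbT invf_ple ?posrE//.
    by rewrite (le_trans (nx n (leqnn _)))// ler_nat.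
  have -> : (\int[mu]_(x in `]0%R, +oo[) `|(EFin \o g) x| = \int[mu]_(x in \bigcup_n F n) (g x)%:E)%E.
    by rewrite UF; apply: eq_integral => x _; rewrite /= ger0_norm.
  have cvF : (\int[mu]_(x in F n) (g x)%:E @[n --> \oo] --> \int[mu]_(x in \bigcup_n F n) (g x)%:E)%E.
    apply: ge0_nondecreasing_set_cvg_integral => //.
    - apply/nondecreasing_seqP => n; rewrite subsetEset => x; rewrite /F/= !in_itv/= !andbT.
      by apply: le_trans; rewrite lef_pV2 ?posrE// ler_nat.
    - by move=> n; exact: measurable_itv.
    - move=> n; apply/measurable_EFinP; apply: measurable_funS mg => //.
      by rewrite -UF => x Fx; exists n.
    - by move=> n x _; rewrite lee_fin.
  apply: (@le_lt_trans _ _ (m^-1)%:E); last by rewrite ltry.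
  rewrite -(cvg_lim _ cvF)//; apply: lime_le; first by apply/cvg_ex; exists (\int[mu]_(x in \bigcup_n F n) (g x)%:E)%E.
  apply: nearW => n; rewrite ig ?invr_gt0// lee_fin sub0r /G mulNr opprK.
  have := powR_ge0 (n.+1%:R^-1 : R) m; set q := _ `^ m => q0.
  by rewrite ler_piMr ?invr_ge0 ?(ltW m0)// invf_le1; lra.
have p1 : 1 `^ m = 1 :> R by rewrite powR1.
have C0 : 0 <= C by have := f01 _ ltr01 (lexx _); rewrite powR1 mulr1; exact: le_trans.
apply: (@le_integrable _ _ R mu _ _ _ (EFin \o (fun x => 4 * C * g x))) => //.
- exact/measurable_EFinP.
- move=> x /=; rewrite in_itv/= andbT => x0; rewrite lee_fin.
  rewrite (@le_trans _ _ (4 * C * g x))//; last by rewrite ler_norm.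
  have xm0 : 0 <= x `^ m by exact: powR_ge0.
  have d0 : 0 < (1 + x `^ m) ^+ 2 by rewrite exprn_gt0// ltr_pwDl.
  have [x1|x1] := leP x 1.
    apply: le_trans (f01 _ x0 x1) _; rewrite /g.
    rewrite (mulrC 4) -(mulrA C) ler_wpM2l// mulrCA ler_peMr ?powR_ge0//.
    have : x `^ m <= 1 by rewrite -[leRHS]p1 ge0_ler_powR ?nnegrE//; lra.
    move=> xm1; rewrite ler_pdivlMr// mul1r; nra.
  apply: le_trans (f1y _ (ltW x1)) _; rewrite /g.
  rewrite (mulrC 4) -(mulrA C) ler_wpM2l//.
  have -> : x `^ (- m - 1) = x `^ (m - 1) / (x `^ m) ^+ 2.
    rewrite -powR_mulrn// -powRrM -powRB; last by apply/implyP => _; rewrite gt_eqF.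
    by congr (_ `^ _); ring.
  rewrite mulrCA ler_wpM2l ?powR_ge0//.
  have : 1 <= x `^ m by rewrite -[leLHS]p1 ge0_ler_powR ?nnegrE//; lra.
  move=> xm1; rewrite ler_pdivlMr// mulrC ler_pdivrMr ?exprn_gt0 ?powR_gt0//; nra.
- by apply: (@integrableZl _ _ R mu _ _ (4 * C) (EFin \o g)).
Qed.

End integrability_test.

(** * Affine change of variables *)

Section affine_change.
Context {R : realType}.
Local Notation mu := (@lebesgue_measure R).
Local Notation Rintegrable D f := (mu.-integrable D (EFin \o f)).
Implicit Types (D : set R) (f g F : R -> R).

(** Uniqueness of Lebesgue measure: the right-hand side is a measure in [A], and it suffices to
    compare it with [mu] on half-open intervals. For [c < 0] the preimage of such an interval is
    closed at the other end, hence the two computations. *)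
Lemma lebesgue_measure_affine (c d : R) (A : set R) : c != 0 -> measurable A ->
  mu A = (`|c|%:E * mu ((fun x => (c * x + d)%R) @^-1` A))%E.
Proof.
move=> c0 mA.
have mphi : measurable_fun setT (fun x : measurableTypeR R => (c * (x : R) + d) : measurableTypeR R).
  by apply: measurable_funD => //; exact: measurable_funM.
pose phi : {mfun measurableTypeR R >-> measurableTypeR R} :=
  HB.pack (fun x : measurableTypeR R => (c * (x : R) + d) : measurableTypeR R) (isMeasurableFun.Build _ _ _ _ _ mphi).
have c'0 : 0 <= `|c| by [].
have := @lebesgue_measure_unique R (mscale (NngNum c'0) (pushforward mu phi : {measure set (measurableTypeR R) -> \bar R})).
move=> H; apply: H => // _ [[a b]] _ <-.
have [c1|c1|c1] := ltgtP c 0.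
- transitivity (`|c|%:E * mu `[((b - d) / c)%R, ((a - d) / c)%R[%classic)%E.
    rewrite ltr0_norm// !lebesgue_measure_itv/= !lte_fin ltr_nM2r ?invr_lt0//.
    rewrite ltrD2r; case: ifPn => ab; last by rewrite mule0.
    rewrite -!EFinB -EFinM; congr (_%:E); field.
    by rewrite lt_eqF.
  congr (_ * mu _)%E; apply/seteqP; split => x /=.
    rewrite !in_itv/= ler_ndivrMr// ltr_ndivlMr// => /andP[h1 h2]; apply/andP; split; lra.
  by rewrite !in_itv/= ler_ndivrMr// ltr_ndivlMr// => /andP[h1 h2]; apply/andP; split; lra.
- transitivity (`|c|%:E * mu `]((a - d) / c)%R, ((b - d) / c)%R]%classic)%E.
    rewrite gtr0_norm// !lebesgue_measure_itv/= !lte_fin ltr_pM2r ?invr_gt0//.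
    rewrite ltrD2r; case: ifPn => ab; last by rewrite mule0.
    rewrite -!EFinB -EFinM; congr (_%:E); field.
    by rewrite gt_eqF.
  congr (_ * mu _)%E; apply/seteqP; split => x /=.
    rewrite !in_itv/= ltr_pdivrMr// ler_pdivlMr// => /andP[h1 h2]; apply/andP; split; lra.
  by rewrite !in_itv/= ltr_pdivrMr// ler_pdivlMr// => /andP[h1 h2]; apply/andP; split; lra.
- by rewrite c1 eqxx in c0.
Qed.

Lemma measurable_affine (c d : R) : measurable_fun setT (fun x : R => c * x + d).
Proof. by apply: measurable_funD => //; exact: measurable_funM. Qed.

Lemma ge0_integral_affine (c d : R) D (f : R -> \bar R) : c != 0 -> measurable D ->
  measurable_fun D f -> (forall x, D x -> 0 <= f x)%E ->
  (\int[mu]_(x in D) f x =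
  `|c|%:E * \int[mu]_(x in (fun x : R => (c * x + d)%R) @^-1` D) f (c * x + d)%R)%E.
Proof.
move=> c0 mD mf f0.
have mphi : measurable_fun setT (fun x : measurableTypeR R => (c * (x : R) + d) : measurableTypeR R).
  exact: measurable_affine.
pose phi : {mfun measurableTypeR R >-> measurableTypeR R} :=
  HB.pack (fun x : measurableTypeR R => (c * (x : R) + d) : measurableTypeR R) (isMeasurableFun.Build _ _ _ _ _ mphi).
have c'0 : 0 <= `|c| by [].
rewrite -(@ge0_integral_pushforward _ _ _ _ _ phi)//; last first.
  by move=> x /set_mem; exact: f0.
rewrite -[`|c|%:E]/((NngNum c'0)%:num%:E) -ge0_integral_mscale//.
by apply: eq_measure_integral => //= A mA _; exact: (lebesgue_measure_affine d c0 mA).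
Qed.

Lemma Rintegrable_affine (c d : R) D f : c != 0 -> measurable D ->
  Rintegrable D f ->
  Rintegrable ((fun x : R => c * x + d) @^-1` D) (fun x => f (c * x + d)).
Proof.
move=> c0 mD /integrableP[mf intf]; apply/integrableP; split.
  apply/measurable_EFinP; move/measurable_EFinP : mf => mf.
  apply: (@measurable_comp _ _ _ _ _ _ D) => //; first by move=> _ [x Dx <-].
  apply: (measurable_funS (@measurableT _ _)) => //; exact: (measurable_affine c d).
rewrite (@ge0_integral_affine c d)// in intf; last exact: measurableT_comp.
move: intf; case: (\int[mu]_(x in _) _)%E => [r| |]//=; first by rewrite !ltry.
by rewrite gt0_muley// lte_fin normr_gt0.
Qed.

Lemma Rintegral_affine (c d : R) D f : c != 0 -> measurable D ->
  Rintegrable D f ->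
  \int[mu]_(x in D) f x =
  `|c| * \int[mu]_(x in (fun x : R => c * x + d) @^-1` D) f (c * x + d).
Proof.
move=> c0 mD intf; have intf' := Rintegrable_affine d c0 mD intf.
have mf : measurable_fun D (EFin \o f) by case/integrableP : intf.
have mD' : measurable ((fun x : R => c * x + d) @^-1` D).
  by rewrite -[X in measurable X]setTI; exact: measurable_affine.
pose g x := f (c * x + d).
have Ep : (\int[mu]_(x in D) (EFin \o f)^\+ x = `|c|%:E *
    \int[mu]_(x in (fun x : R => (c * x + d)%R) @^-1` D) (EFin \o g)^\+ x)%E.
  rewrite (@ge0_integral_affine c d)//; last exact: measurable_funepos.
  by congr (_ * _)%E; apply: eq_integral => x _; rewrite !funeposE.
have En : (\int[mu]_(x in D) (EFin \o f)^\- x = `|c|%:E *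
    \int[mu]_(x in (fun x : R => (c * x + d)%R) @^-1` D) (EFin \o g)^\- x)%E.
  rewrite (@ge0_integral_affine c d)//; last exact: measurable_funeneg.
  by congr (_ * _)%E; apply: eq_integral => x _; rewrite !funenegE.
rewrite /Rintegral [in LHS]integralE Ep En.
rewrite -muleBr//; last exact: (@integrable_add_def _ _ R mu _ mD' _ intf').
have := @integrable_fin_num _ _ R mu _ mD' _ intf'; rewrite integralE => h.
by rewrite fineM// [in RHS]integralE.
Qed.

End affine_change.

(** * Exchange of real-valued integrals *)

Section fubini.
Context {R : realType}.
Local Notation mu := (@lebesgue_measure R).
Local Notation Rintegrable D f := (mu.-integrable D (EFin \o f)).
Implicit Types (D : set R) (f g F : R -> R).

(** Fubini on the whole plane for [g] cut off by the indicators of [D] and [E]; the bound by [h]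
    makes the iterated integral of the absolute value finite, which by Tonelli is integrability for
    the product measure. Integrability of every section ensures that the real-valued inner integrals
    agree with the extended ones at each point. *)
Lemma Rintegral_Fubini D E (g : R -> R -> R) (h : R -> R) : measurable D -> measurable E ->
  measurable_fun setT (fun z : R * R => g z.1 z.2) ->
  (forall x, D x -> Rintegrable E (g x)) ->
  (forall y, E y -> Rintegrable D (g ^~ y)) ->
  (forall x, D x -> \int[mu]_(y in E) `|g x y| <= h x) -> Rintegrable D h ->
  \int[mu]_(x in D) \int[mu]_(y in E) g x y =
  \int[mu]_(y in E) \int[mu]_(x in D) g x y.
Proof.
move=> mD mE mg gE gD gh ih.
pose f (z : R * R) : \bar R := (g z.1 z.2 * \1_D z.1 * \1_E z.2)%:E.
have mf : measurable_fun setT f.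
  apply/measurable_EFinP/measurable_funM; first apply/measurable_funM => //.
  - exact: measurableT_comp.
  - exact: measurableT_comp.
have fE x : (\int[mu]_y f (x, y) = ((fun x => \int[mu]_(y in E) g x y) \_ D x)%:E)%E.
  rewrite patchE; case: ifPn => xD; last first.
    rewrite integral0_eq// => y _; rewrite /f/= indicE (negbTE xD) mulr0 mul0r//.
  rewrite /Rintegral fineK; last by apply: integrable_fin_num => //; apply/gE/set_mem.
  rewrite [RHS]integral_mkcond; apply: eq_integral => y _.
  by rewrite /f/= !indicE xD mulr1 patchE; case: ifPn; rewrite ?mulr1 ?mulr0.
have fD y : (\int[mu]_x f (x, y) = ((fun y => \int[mu]_(x in D) g x y) \_ E y)%:E)%E.
  rewrite patchE; case: ifPn => yE; last first.
    by rewrite integral0_eq// => x _; rewrite /f/= indicE [X in _ * X]indicE (negbTE yE) mulr0.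
  rewrite /Rintegral fineK; last by apply: integrable_fin_num => //; apply/gD/set_mem.
  rewrite [RHS]integral_mkcond; apply: eq_integral => x _.
  by rewrite /f/= !indicE yE mulr1 patchE; case: ifPn; rewrite ?mulr1 ?mulr0.
have afE x : (\int[mu]_y `|f (x, y)| = ((fun x => \int[mu]_(y in E) `|g x y|) \_ D x)%:E)%E.
  rewrite patchE; case: ifPn => xD; last first.
    rewrite integral0_eq// => y _; rewrite /f/= indicE (negbTE xD) mulr0 mul0r normr0//.
  rewrite /Rintegral fineK; last first.
    by apply: integrable_fin_num => //; apply/integrable_norm/gE/set_mem.
  rewrite [RHS]integral_mkcond; apply: eq_integral => y _.
  by rewrite /f/= !indicE xD mulr1 patchE; case: ifPn; rewrite ?mulr1 ?mulr0 ?normr0.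
have intf : (mu \x mu)%E.-integrable setT f.
  apply/integrable12ltyP => //.
  have mF : measurable_fun setT (fun x => \int[mu]_y `|f (x, y)|)%E.
    have maf : measurable_fun setT (abse \o f) by apply: measurableT_comp.
    have f0 (z : R * R) : (0 <= (abse \o f) z)%E by exact: abse_ge0.
    have := @measurable_fun_fubini_tonelli_F _ _ _ _ R mu (abse \o f) maf f0.
    exact.
  move/integrableP : ih => [/measurable_EFinP mh].
  rewrite [X in (X < _)%E -> _]integral_mkcond; apply: le_lt_trans.
  apply: ge0_le_integral => //.
  - by move=> x _; apply: integral_ge0.
  - apply/(measurable_restrictT _ _).1 => //; apply: measurableT_comp => //.
    exact/measurable_EFinP.
  - move=> x _; rewrite afE !patchE; case: ifPn => //= xD.
    by rewrite lee_fin (le_trans (gh _ (set_mem xD)))// ler_norm.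
rewrite Rintegral_mkcond [RHS]Rintegral_mkcond /Rintegral; congr fine.
under eq_integral do rewrite -fE.
under [RHS]eq_integral do rewrite -fD.
exact: Fubini.
Qed.

End fubini.

(** * Scaling and reflection on the half line, and two elementary inequalities *)

Section half_line.
Context {R : realType}.
Local Notation mu := (@lebesgue_measure R).
Local Notation Rintegrable D f := (mu.-integrable D (EFin \o f)).

Lemma Rintegral_scale (f : R -> R) (c : R) : 0 < c -> Rintegrable `]0, +oo[ f ->
  Rintegrable `]0, +oo[ (fun x => f (c * x)) /\
  \int[mu]_(x in `]0, +oo[) f (c * x) = c^-1 * \int[mu]_(x in `]0, +oo[) f x.
Proof.
move=> c0 intf; have cn0 : c != 0 by rewrite gt_eqF.
have E : (fun x : R => c * x + 0) @^-1` `]0, +oo[ = `]0, +oo[%classic.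
  by apply/seteqP; split => x /=; rewrite !in_itv/= !andbT addr0 pmulr_rgt0.
have Ef : (fun x => f (c * x + 0)) = (fun x => f (c * x)).
  by apply/funext => x; rewrite addr0.
have := Rintegrable_affine 0 cn0 (measurable_itv _) intf.
have := Rintegral_affine 0 cn0 (measurable_itv _) intf.
by rewrite E Ef => -> ?; rewrite gtr0_norm// mulKf.
Qed.

Lemma Rintegral_symT (f : R -> R) : measurable_fun setT f ->
  Rintegrable `]0, +oo[ f -> Rintegrable `]0, +oo[ (fun x => f (- x)) ->
  Rintegrable setT f /\ \int[mu]_x f x = \int[mu]_(x in `]0, +oo[) (f x + f (- x)).
Proof.
move=> mf I1 I2; have n1 : (-1 : R) != 0 by [].
have E : (fun x : R => -1 * x + 0) @^-1` `]0, +oo[ = `]-oo, 0[%classic.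
  by apply/seteqP; split => x /=; rewrite !in_itv/= ?andbT addr0 mulN1r oppr_gt0.
have Ef : (fun x => f (- (-1 * x + 0))) = f.
  by apply/funext => x; rewrite addr0 mulN1r opprK.
have := Rintegrable_affine 0 n1 (measurable_itv _) I2.
have := Rintegral_affine 0 n1 (measurable_itv _) I2.
rewrite E Ef normrN1 mul1r => E3 I3.
have D0 : setT `\` [set 0] = `]-oo, 0[ `|` `]0, +oo[%classic :> set R.
  apply/seteqP; split => x /=; rewrite !in_itv/= ?andbT.
    by move=> [_ /eqP]; rewrite neq_lt => /orP[]; [left|right].
  by move=> [x0|x0]; split => //; apply/eqP; [rewrite lt_eqF|rewrite gt_eqF].
have dis : [disjoint `]-oo, (0 : R)[%classic & `]0, +oo[%classic].
  by apply/disj_setPS => x [/=]; rewrite !in_itv/= andbT => h1 h2; have := lt_trans h1 h2; rewrite ltxx.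
have mF : measurable_fun setT (EFin \o f) by exact/measurable_EFinP.
have ID : Rintegrable (`]-oo, 0[ `|` `]0, +oo[) f.
  apply/integrableP; split; first exact: measurable_funTS.
  rewrite ge0_integral_setU//; last by apply: measurable_funTS; exact: measurableT_comp.
  by move/integrableP : I3 => [_ I3]; move/integrableP : I1 => [_ I1]; exact: lte_add_pinfty.
have z0 : mu [set (0 : R)] = 0%E by exact: lebesgue_measure_set1.
have IT : Rintegrable setT f.
  have [_ H] := @negligible_integrable _ _ _ mu _ _ _ (measurable_set1 (0 : R)) measurableT mF z0.
  by apply: H; rewrite D0.
split => //.
rewrite RintegralD// E3 addrC -Rintegral_setU//.
by rewrite /Rintegral (@negligible_integral _ _ _ mu _ _ _ (measurable_set1 (0 : R)) measurableT IT z0) D0.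
Qed.

Lemma norm_sin_le (x : R) : `|sin x| <= `|x|.
Proof.
wlog x0 : x / 0 < x.
  move=> H; have [x0|x0|e0] := ltgtP 0 x; [exact: H| |by rewrite -e0 sin0].
  by rewrite -normrN -sinN -[leRHS]normrN; apply: H; rewrite oppr_gt0.
have cs : {within `[0, x], continuous sin} by apply: continuous_subspaceT; exact: continuous_sin.
have [c _] := MVT x0 (fun y _ => is_derive_sin y) cs.
by rewrite sin0 !subr0 => ->; rewrite normrM ler_piMl// cos_max.
Qed.

(** This is the inequality x / s <= exp (x / s) raised to the power [s]. *)
Lemma expRN_le_powR (s x : R) : 0 < s -> 0 < x -> expR (- x) <= s `^ s * x `^ (- s).
Proof.
move=> s0 x0; have xs0 : 0 < x / s by rewrite divr_gt0.
have h : (x / s) `^ s <= expR x.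
  rewrite -[X in expR X](@divfK _ s) ?gt_eqF// expRM ge0_ler_powR ?nnegrE ?expR_ge0 ?(ltW s0) ?(ltW xs0)//.
  by rewrite (le_trans _ (expR_ge1Dx _))// lerDr.
rewrite expRN powRN invf_ple ?posrE ?expR_gt0 ?mulr_gt0 ?invr_gt0 ?powR_gt0//.
rewrite invfM invrK mulrC; apply: le_trans h; rewrite powRM ?invr_ge0 ?(ltW s0) ?(ltW x0)//.
by rewrite ler_wpM2l ?powR_ge0// -powR_inv1 ?(ltW s0)// -powRrM mulN1r powRN.
Qed.

End half_line.

(** * The integral of u^b / (1 + u^2) *)

Section cosine_moments.
Context {R : realType}.
Local Notation mu := (@lebesgue_measure R).
Local Notation Rintegrable D f := (mu.-integrable D (EFin \o f)).
Implicit Types (b x u : R) (n : nat).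

Definition cos_moment b n : R := \int[mu]_(x in `[0, pi / 2]) (cos (b * x) * cos x ^+ n).

Lemma Rintegrable_itvcc (f : R -> R) (a c : R) : continuous f -> Rintegrable `[a, c] f.
Proof.
move=> cf; apply: continuous_compact_integrable; first exact: segment_compact.
exact: continuous_subspaceT.
Qed.

Lemma continuous_cos_moment b n : continuous (fun x => cos (b * x) * cos x ^+ n).
Proof. by move=> x; apply_continuous; deriv. Qed.

Lemma cos_moment_rec b n :
  (n.+2%:R ^+ 2 - b ^+ 2) * cos_moment b n.+2 = n.+2%:R * n.+1%:R * cos_moment b n.
Proof.
apply/eqP; rewrite -subr_eq0; apply/eqP.
rewrite /cos_moment -!RintegralZl//; [|apply: Rintegrable_itvcc; exact: continuous_cos_moment..].
rewrite -RintegralB//; last 2 first.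
- by apply: Rintegrable_itvcc => x; apply: cvgMr; exact: continuous_cos_moment.
- by apply: Rintegrable_itvcc => x; apply: cvgMr; exact: continuous_cos_moment.
pose f (x : R) : R := (n.+2%:R ^+ 2 - b ^+ 2) * (cos (b * x) * cos x ^+ n.+2) -
  n.+2%:R * n.+1%:R * (cos (b * x) * cos x ^+ n).
(* The antiderivative is the Wronskian F' G - F G' of F = cos (b x) and G = cos^(n+2) x, whose
   derivative is F'' G - F G''. It vanishes at 0 through the sines and at pi/2 through the powers of
   the cosine. *)
apply: etrans; first apply: (@Rintegral_FTC _ f (fun x => b * - sin (b * x) * cos x ^+ n.+2 + n.+2%:R * cos (b * x) * cos x ^+ n.+1 * sin x)).
- by rewrite divr_ge0 ?pi_ge0.
- by move=> x _; rewrite /f; apply_continuous; deriv.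
- move=> x _; apply_is_derive; first by deriv.
  rewrite /f/=.
  have cs := sin2cos2 x.
  rewrite -!natr1 !exprS; ring: cs.
by rewrite /= cos_pihalf mulr0 sin0 !expr0n /=; ring.
Qed.

Lemma cos_moment1 b : b ^+ 2 != 1 -> cos_moment b 1 = cos (b * pi / 2) / (1 - b ^+ 2).
Proof.
move=> b1; have b1' : 1 - b ^+ 2 != 0 by rewrite subr_eq0 eq_sym.
rewrite /cos_moment; apply: etrans; first apply: (@Rintegral_FTC _ _ (fun x => (cos (b * x) * sin x - b * sin (b * x) * cos x) / (1 - b ^+ 2))).
- by rewrite divr_ge0 ?pi_ge0.
- by move=> x _; exact: continuous_cos_moment.
- move=> x _; apply_is_derive; first by deriv.
  rewrite /=; field; exact: b1'.
by rewrite /= cos_pihalf sin_pihalf !(mulr0, sin0) mulrA; ring.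
Qed.

Lemma cos_moment0_gt0 n : 0 < cos_moment 0 n.
Proof.
suff : 0 < cos_moment 0 n /\ 0 < cos_moment 0 n.+1 by case.
elim: n => [|n [c0 c1]]; split => //.
- rewrite /cos_moment; under eq_Rintegral do rewrite mul0r cos0 expr0 mulr1.
  rewrite Rintegral_cst//= lebesgue_measure_itv/= lte_fin divr_gt0 ?pi_gt0//.
  by rewrite -EFinB/= subr0 mul1r divr_gt0 ?pi_gt0.
- have := @cos_moment1 0; rewrite expr0n/= eq_sym oner_eq0 => /(_ isT) ->.
  by rewrite !mul0r cos0 subr0 divr1.
- have := cos_moment_rec 0 n; rewrite expr0n/= subr0 => E.
  have : 0 < n.+2%:R * n.+1%:R * cos_moment 0 n by rewrite !mulr_gt0.
  by rewrite -E pmulr_rgt0// exprn_gt0.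
Qed.

(** The lower bound comes from cos (b x) >= 2 cos^2 x - 1 on the interval of integration. At b = 0
    the recurrence gives the quotient (n+1)/(n+2) of the moments of orders n+2 and n, and 2
    (n+1)/(n+2) - 1 = 1 - 2/(n+2). *)
Lemma cos_moment_ratio b n : 0 <= b <= 1 ->
  1 - 2 / n.+2%:R <= cos_moment b n / cos_moment 0 n <= 1.
Proof.
move=> /andP[b0 b1]; have c0 := cos_moment0_gt0 n.
have H (f : R -> R) : continuous f -> Rintegrable `[0, pi / 2] f by exact: Rintegrable_itvcc.
have cc x : 0 <= x <= pi / 2 -> 0 <= cos x.
  by move=> /andP[x0 xp]; apply: cos_ge0_pihalf; rewrite xp andbT; have := @pi_gt0 R; lra.
rewrite ler_pdivlMr// ler_pdivrMr// mul1r; apply/andP; split; last first.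
  apply: le_Rintegral => //; [apply: H; exact: continuous_cos_moment..|].
  move=> x /=; rewrite in_itv/= => xp; by rewrite mul0r cos0 ler_wpM2r ?exprn_ge0 ?cc ?cos_le1.
have -> : (1 - 2 / n.+2%:R) * cos_moment 0 n = 2 * cos_moment 0 n.+2 - cos_moment 0 n.
  have := cos_moment_rec 0 n; rewrite expr0n subr0.
  have -> : n.+1%:R = n.+2%:R - 1 :> R by rewrite -[n.+2%:R]natr1 addrK.
  have : n.+2%:R != 0 :> R by [].
  set N : R := n.+2%:R => N0; rewrite expr2 -!mulrA => /(mulfI N0) E.
  by apply: (mulfI N0); rewrite mulrBr (mulrCA _ 2) E; field.
rewrite /cos_moment -RintegralZl//; last by apply: H; exact: continuous_cos_moment.
rewrite -RintegralB//; [|by apply: H => x; apply: cvgMr; exact: continuous_cos_moment|apply: H; exact: continuous_cos_moment].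
apply: le_Rintegral => //; [|by apply: H; exact: continuous_cos_moment|].
  apply: H => x; apply: cvgB; last exact: continuous_cos_moment.
  by apply: cvgMr; exact: continuous_cos_moment.
move=> x /=; rewrite in_itv/= => xp; rewrite mul0r cos0 !mul1r.
rewrite !exprS mulrA mulrA -{2}(mul1r (cos x ^+ n)) -mulrBl ler_wpM2r ?exprn_ge0 ?cc//.
have -> : b * x = (b * x / 2) *+ 2 by rewrite mulr2n -splitr.
rewrite cos_mulr2n.
(* 1 - cos (b x) = 2 sin^2 (b x / 2) <= 2 sin^2 x *)
have : sin (b * x / 2) ^+ 2 <= sin x ^+ 2.
  move: xp => /andP[x0 xp]; have p0 := @pi_gt0 R.
  have h1 : 0 <= b * x / 2 by rewrite !mulr_ge0.
  have h2 : b * x / 2 <= x by nra.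
  rewrite ler_sqr ?nnegrE ?sin_ge0_pi//; [|lra|lra].
  rewrite leNgt; apply/negP => /=; rewrite ltr_sin ?in_itv/=; lra.
have := sin2cos2 (b * x / 2); have := sin2cos2 x; lra.
Qed.

End cosine_moments.

(** * Moments of powers of u / (1 + u^2) *)

Section mellin_moments.
Context {R : realType}.
Local Notation mu := (@lebesgue_measure R).
Local Notation Rintegrable D f := (mu.-integrable D (EFin \o f)).
Implicit Types (b x u : R) (n : nat).

Lemma cvg0_le_norm {T : Type} {F : set_system T} {FF : Filter F} (f g : T -> R) :
  (\forall t \near F, `|f t| <= g t) -> g @ F --> (0 : R) -> f @ F --> (0 : R).
Proof.
move=> fg g0.
have g0N : (fun t => - g t) @ F --> (0 : R) by rewrite -oppr0; exact: cvgN.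
by apply: squeeze_cvgr g0N g0; apply: filterS fg => t; rewrite ler_norml.
Qed.

Lemma powRN_cvgy0 (c : R) : 0 < c -> x `^ (- c) @[x --> +oo] --> (0 : R).
Proof.
move=> c0; under eq_fun do rewrite powRN.
apply/gtr0_cvgV0; last exact: powR_cvgy.
by near=> x; rewrite powR_gt0//; near: x; exact: nbhs_pinfty_gt.
Unshelve. all: by end_near. Qed.

(* For u = exp v this is 1 / (2 cosh v). *)
Definition sech_exp u : R := u / (1 + u ^+ 2).
Local Notation S := sech_exp.

Lemma oneDsqr_gt0 u : 0 < 1 + u ^+ 2.
Proof. by rewrite ltr_pwDl// sqr_ge0. Qed.
Local Hint Resolve oneDsqr_gt0 : core.

Lemma sech_exp_ge0 u : 0 <= u -> 0 <= S u.
Proof. by move=> u0; rewrite divr_ge0// ltW. Qed.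

Lemma sech_exp_le u : 0 <= u -> S u <= u.
Proof. by move=> u0; rewrite ler_pdivrMr// ler_peMr// lerDl sqr_ge0. Qed.

Lemma sech_exp_leV u : 0 < u -> S u <= u^-1.
Proof. by move=> u0; rewrite ler_pdivrMr// mulrC ler_pdivlMr// -expr2 lerDr. Qed.

Lemma sech_exp_le1 u : 0 <= u -> S u <= 1.
Proof. by move=> u0; rewrite ler_pdivrMr// mul1r; nra. Qed.

Definition sech_moment b n : R := \int[mu]_(u in `]0, +oo[) (u `^ (b - 1) * S u ^+ n).

Lemma sech_moment_continuous b n u : 0 < u -> {for u, continuous (fun u => u `^ (b - 1) * S u ^+ n)}.
Proof.
by move=> u0; rewrite /S; apply_continuous; deriv => //; rewrite gt_eqF.
Qed.

Lemma sech_moment_integrable b n : `|b| < n%:R ->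
  Rintegrable `]0, +oo[ (fun u => u `^ (b - 1) * S u ^+ n).
Proof.
move=> bn; apply: (@Rintegrable_powR_test _ _ (n%:R - `|b|) 1); first by rewrite subr_gt0.
- apply: open_continuous_measurable_fun => // x.
  by rewrite inE/= in_itv/= andbT; exact: sech_moment_continuous.
- move=> u u0 u1; have u0' := ltW u0; rewrite mul1r ger0_norm ?mulr_ge0 ?powR_ge0 ?exprn_ge0 ?sech_exp_ge0//.
  rewrite (@le_trans _ _ (u `^ (b - 1) * u `^ n%:R))//.
    rewrite ler_wpM2l ?powR_ge0// powR_mulrn// lerXn2r ?nnegrE ?sech_exp_ge0 ?sech_exp_le//.
  rewrite -powRD; last by rewrite (gt_eqF u0) implybT.
  by apply: ger_powR; rewrite ?u0//; have := ler_norm (- b); rewrite normrN; lra.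
- move=> u u1; have u0 : 0 < u by lra.
  have u0' := ltW u0.
  rewrite mul1r ger0_norm ?mulr_ge0 ?powR_ge0 ?exprn_ge0 ?sech_exp_ge0//.
  rewrite (@le_trans _ _ (u `^ (b - 1) * u `^ (- n%:R)))//.
    rewrite ler_wpM2l ?powR_ge0// powR_invn// -exprVn lerXn2r ?nnegrE ?invr_ge0 ?sech_exp_ge0 ?sech_exp_leV//.
  rewrite -powRD; last by rewrite (gt_eqF u0) implybT.
  by apply: ler_powR => //; have := ler_norm b; lra.
Qed.

Lemma sech_moment_rec b n : 0 <= b < 1 ->
  (n.+1%:R ^+ 2 - b ^+ 2) * sech_moment b n.+1 =
  4 * n.+1%:R * n.+2%:R * sech_moment b n.+3.
Proof.
move=> /andP[b0 b1].
have I1 k : Rintegrable `]0, +oo[ (fun u => u `^ (b - 1) * S u ^+ k.+1).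
  by apply: sech_moment_integrable; rewrite ger0_norm// (lt_le_trans b1)// ler1n.
apply/eqP; rewrite -subr_eq0; apply/eqP.
rewrite /sech_moment -!RintegralZl//.
have I2 k (a : R) : Rintegrable `]0, +oo[ (fun u => a * (u `^ (b - 1) * S u ^+ k.+1)).
  exact: (@integrableZl _ _ _ mu _ _ a (EFin \o (fun u => u `^ (b - 1) * S u ^+ k.+1))).
rewrite -RintegralB//.
rewrite -[RHS](subrr (0 : R)).
(* In the variable v = ln u this is again a Wronskian F G' - F' G, now of F = exp (b v) and G = (2
   cosh v)^(-n-1), since (1 - u^2)/(1 + u^2) = - tanh v. The bound [GE] makes it vanish like u at 0
   and like u^(b-1) at infinity. *)
pose G u : R := u `^ b * S u ^+ n.+1 * (n.+1%:R * ((1 - u ^+ 2) / (1 + u ^+ 2)) - b).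
have GE u : 0 <= u -> `|G u| <= (n.+1%:R + b) * (u `^ b * S u).
  move=> u0; rewrite /G normrM mulrC ler_pM// ?normr_ge0//.
    rewrite (le_trans (ler_normB _ _))// (ger0_norm b0) lerD2r normrM ger0_norm//.
    rewrite ler_piMr// normrM normfV (gtr0_norm (oneDsqr_gt0 u)) ler_pdivrMr// mul1r.
    by rewrite (le_trans (ler_normB _ _))// normr1 ger0_norm ?sqr_ge0.
  rewrite ger0_norm ?mulr_ge0 ?powR_ge0 ?exprn_ge0 ?sech_exp_ge0//.
  rewrite ler_wpM2l ?powR_ge0// exprS ler_piMr ?sech_exp_ge0//.
  by rewrite exprn_ile1 ?sech_exp_ge0 ?sech_exp_le1.
pose f u : R := (n.+1%:R ^+ 2 - b ^+ 2) * (u `^ (b - 1) * S u ^+ n.+1) -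
  4 * n.+1%:R * n.+2%:R * (u `^ (b - 1) * S u ^+ n.+3).
apply: (@Rintegral_FTC0y _ f G).
- by move=> u u0; rewrite /f /S; apply_continuous; deriv => //; rewrite gt_eqF.
- move=> u u0; rewrite /G /f /S; apply_is_derive; first by deriv => //; rewrite gt_eqF.
  have -> : u `^ b = u * u `^ (b - 1).
    rewrite -{2}[u]powRr1 ?ltW// -powRD; last by rewrite (gt_eqF u0) implybT.
    by congr (_ `^ _); ring.
  rewrite /= !exprS -!natr1; field.
  by rewrite -expr2 gt_eqF.
- apply: (@cvg0_le_norm _ _ _ G (fun u => (n.+1%:R + b) * u)).
    near=> u; have u0 : 0 < u by [].
    have u0' := ltW u0; have u1 : u <= 1 by near: u; apply: nbhs_right_le.
    rewrite (le_trans (GE _ (ltW u0)))// ler_wpM2l ?addr_ge0//.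
    rewrite -[leRHS]mul1r ler_pM ?powR_ge0 ?sech_exp_ge0 ?sech_exp_le//.
    by rewrite -[leRHS](powRr0 u); apply: ger_powR; rewrite ?u0//.
  rewrite -[X in _ --> X](mulr0 (n.+1%:R + b)); apply: cvg_at_right_filter; apply: cvgMr; exact: cvg_id.
- apply: (@cvg0_le_norm _ _ _ G (fun u => (n.+1%:R + b) * u `^ (- (1 - b)))).
    near=> u; have u0 : 0 < u by near: u; exact: nbhs_pinfty_gt.
    rewrite (le_trans (GE _ (ltW u0)))// ler_wpM2l ?addr_ge0//.
    have -> : u `^ (- (1 - b)) = u `^ b * u^-1.
      rewrite -powR_inv1 ?ltW// -powRD; last by rewrite (gt_eqF u0) implybT.
      by congr (_ `^ _); ring.
    by rewrite ler_wpM2l ?powR_ge0// sech_exp_leV.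
  rewrite -[X in _ --> X](mulr0 (n.+1%:R + b)); apply: cvgMr; apply: powRN_cvgy0; lra.
- exact: (@integrableB _ _ _ mu _ _ (EFin \o _) (EFin \o _) (I2 _ _) (I2 _ _)).
Unshelve. all: by end_near. Qed.

Lemma sech_moment0_1 : sech_moment 0 1 = pi / 2.
Proof.
rewrite /sech_moment -[RHS]subr0 -[X in _ = _ - X](@atan0 R).
have E u : 0 < u -> u `^ (0 - 1) * S u ^+ 1 = (1 + u ^+ 2)^-1.
  move=> u0; rewrite sub0r powR_inv1 ?ltW// /S; field.
  by rewrite !gt_eqF.
apply: (@Rintegral_FTC0y _ (fun u => u `^ (0 - 1) * S u ^+ 1) atan).
- exact: sech_moment_continuous.
- by move=> u u0; rewrite E//; exact: is_derive1_atan.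
- by apply: cvg_at_right_filter; exact: continuous_atan.
- exact: cvgy_atan.
- by apply: sech_moment_integrable; rewrite normr0.
Qed.

(** Positivity propagates along the recurrence, which moves by two from the explicit value at order
    1; hence only odd orders. *)
Lemma sech_moment_odd_gt0 n : 0 < sech_moment 0 n.*2.+1.
Proof.
elim: n => [|n IH]; first by rewrite sech_moment0_1 divr_gt0 ?pi_gt0.
have := @sech_moment_rec 0 n.*2; rewrite lexx ltr01 expr0n/= subr0 => /(_ isT) E.
have : 0 < n.*2.+1%:R ^+ 2 * sech_moment 0 n.*2.+1 by rewrite mulr_gt0// exprn_gt0.
by rewrite E doubleS pmulr_rgt0.
Qed.

(** Since u^b lies between 1 and u, its distance to 1 is at most that of u to 1/u. The
    arithmetic-geometric inequality then trades the absolute value for a square, which is a rational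
    function. *)
Lemma norm_powR_sub1_le b u (e : R) : 0 <= b <= 1 -> 0 < u -> 0 < e ->
  `|u `^ b - 1| <= e + (u - u^-1) ^+ 2 / (4 * e).
Proof.
move=> /andP[b0 b1] u0 e0; set w := u - u^-1; have u0' := ltW u0.
have h : `|u `^ b - 1| <= `|w|.
  have uV : u * u^-1 = 1 by rewrite divff ?gt_eqF.
  have u'0 : 0 < u^-1 by rewrite invr_gt0.
  have [u1|u1] := leP 1 u.
    have ub1 : 1 <= u `^ b by rewrite -[leLHS](powRr0 u); apply: ler_powR.
    have ubu : u `^ b <= u by rewrite -[leRHS]powRr1//; apply: ler_powR.
    by rewrite /w !ger0_norm; nra.
  have u1' := ltW u1; have ub1 : u `^ b <= 1 by rewrite -[leRHS](powRr0 u); apply: ger_powR; rewrite ?u0//.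
  have ubu : u <= u `^ b by rewrite -[leLHS]powRr1//; apply: ger_powR; rewrite ?u0//.
  by rewrite /w !ler0_norm; nra.
apply: (le_trans h); rewrite -subr_ge0 -(@real_normK _ w) ?num_real//.
have -> : e + `|w| ^+ 2 / (4 * e) - `|w| = (`|w| - 2 * e) ^+ 2 / (4 * e).
  by field; rewrite gt_eqF.
by rewrite divr_ge0 ?sqr_ge0// mulr_ge0 ?ltW.
Qed.

(* With w = u - 1/u one has |u^b - 1| <= |w| <= e + w^2/(4e), and
   w^2 S^2 = 1 - 4 S^2 turns the upper bound into two moments at b = 0. *)
Lemma sech_moment_ratio b n (e : R) : 0 <= b < 1 -> 0 < e ->
  0 < sech_moment 0 n.+3 ->
  `|sech_moment b n.+3 / sech_moment 0 n.+3 - 1| <= e + (n.+1%:R * e)^-1.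
Proof.
move=> /andP[b0 b1] e0 A0.
have I0 k : Rintegrable `]0, +oo[ (fun u => u `^ (0 - 1) * S u ^+ k.+1).
  by apply: sech_moment_integrable; rewrite normr0.
have I1 : Rintegrable `]0, +oo[ (fun u => u `^ (b - 1) * S u ^+ n.+3).
  by apply: sech_moment_integrable; rewrite ger0_norm// (lt_le_trans b1)// ler1n.
have IZ k (a : R) : Rintegrable `]0, +oo[ (fun u => a * (u `^ (0 - 1) * S u ^+ k.+1)).
  exact: (@integrableZl _ _ _ mu _ _ a (EFin \o (fun u => u `^ (0 - 1) * S u ^+ k.+1))).
have -> : sech_moment b n.+3 / sech_moment 0 n.+3 - 1 =
    (sech_moment b n.+3 - sech_moment 0 n.+3) / sech_moment 0 n.+3.
  by rewrite mulrBl divff ?gt_eqF.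
rewrite normrM normfV (gtr0_norm A0) ler_pdivrMr//.
rewrite /sech_moment -RintegralB//.
have ID : Rintegrable `]0, +oo[ (fun u => u `^ (b - 1) * S u ^+ n.+3 - u `^ (0 - 1) * S u ^+ n.+3).
  exact: (@integrableB _ _ _ mu _ _ (EFin \o _) (EFin \o _) I1 (I0 _)).
apply: (le_trans (le_normr_Rintegral _ ID)) => //.
have Erec : sech_moment 0 n.+1 = (4 * (1 + n.+1%:R^-1)) * sech_moment 0 n.+3.
  have := @sech_moment_rec 0 n; rewrite lexx ltr01 expr0n/= subr0 => /(_ isT) E.
  apply: (@mulfI _ (n.+1%:R ^+ 2)); first by rewrite expf_neq0.
  by rewrite E -natr1; field.
(* These coefficients expand e + w^2/(4e) against S^(n+3), using w^2 S^(n+3) = S^(n+1) - 4 S^(n+3).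
   After [Erec] the two terms in 1/e cancel and only 1/((n+1) e) is left beside e. *)
pose c1 := e - e^-1; pose c2 := (4 * e)^-1.
have IU : Rintegrable `]0, +oo[ (fun u => c1 * (u `^ (0 - 1) * S u ^+ n.+3) + c2 * (u `^ (0 - 1) * S u ^+ n.+1)).
  exact: (@integrableD _ _ _ mu _ _ (EFin \o _) (EFin \o _) (IZ _ _) (IZ _ _)).
apply: (@le_trans _ _ (\int[mu]_(u in `]0, +oo[) (c1 * (u `^ (0 - 1) * S u ^+ n.+3) + c2 * (u `^ (0 - 1) * S u ^+ n.+1)))).
  apply: le_Rintegral => //; first exact: integrable_norm.
  move=> u /=; rewrite in_itv/= andbT => u0; have u0' := ltW u0.
  have -> : u `^ (b - 1) = u `^ (0 - 1) * u `^ b.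
    rewrite -powRD; last by rewrite (gt_eqF u0) implybT.
    by congr (_ `^ _); ring.
  have w0 : 0 <= u `^ (0 - 1) * S u ^+ n.+3.
    by rewrite mulr_ge0 ?powR_ge0// exprn_ge0// sech_exp_ge0.
  rewrite mulrAC -{2}(mulr1 (_ * S u ^+ _)) -mulrBr normrM (ger0_norm w0).
  have hh : `|u `^ b - 1| <= e + (u - u^-1) ^+ 2 / (4 * e).
    by apply: norm_powR_sub1_le; rewrite // b0 ltW.
  have -> : c1 * (u `^ (0 - 1) * S u ^+ n.+3) + c2 * (u `^ (0 - 1) * S u ^+ n.+1) =
      (u `^ (0 - 1) * S u ^+ n.+3) * (e + (u - u^-1) ^+ 2 / (4 * e)).
    rewrite /c1 /c2 /S !exprS; field.
    by rewrite -expr2 !gt_eqF.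
  by rewrite ler_wpM2l.
rewrite RintegralD// !RintegralZl//.
rewrite -!/(sech_moment 0 _) Erec /c1 /c2 le_eqVlt; apply/orP; left; apply/eqP.
field.
by rewrite nat1r pnatr_eq0 gt_eqF.
Qed.

End mellin_moments.

(** * Evaluation of the integral *)

Section mellin_value.
Context {R : realType}.
Local Notation mu := (@lebesgue_measure R).
Local Notation Rintegrable D f := (mu.-integrable D (EFin \o f)).
Implicit Types (b : R) (n : nat).

(* The recurrences cancel, so the left-hand side does not depend on n. *)
Lemma sech_cos_moment b n : 0 <= b < 1 ->
  sech_moment b n.*2.+3 / sech_moment 0 n.*2.+3 * (cos_moment b n.*2.+1 / cos_moment 0 n.*2.+1) =
  sech_moment b 1 / sech_moment 0 1 * cos (b * pi / 2).
Proof.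
move=> b01; have /andP[b0 b1] := b01.
have bk k : k.+1%:R ^+ 2 - b ^+ 2 != 0.
  by rewrite subr_eq0 gt_eqF// ltrXn2r ?nnegrE// (lt_le_trans b1)// ler1n.
have Rrec k : sech_moment b k.*2.+3 / sech_moment 0 k.*2.+3 =
    (k.*2.+1%:R ^+ 2 - b ^+ 2) / k.*2.+1%:R ^+ 2 * (sech_moment b k.*2.+1 / sech_moment 0 k.*2.+1).
  have := sech_moment_rec k.*2 b01.
  have := @sech_moment_rec R 0 k.*2; rewrite lexx ltr01 expr0n/= subr0 => /(_ isT) E0 E.
  have A1 := sech_moment_odd_gt0 (R := R) k.
  have A3 := sech_moment_odd_gt0 (R := R) k.+1; rewrite doubleS in A3.
  have h : sech_moment 0 k.*2.+3 = k.*2.+1%:R ^+ 2 * sech_moment 0 k.*2.+1 / (4 * k.*2.+1%:R * k.*2.+2%:R) :> R.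
    by rewrite E0 mulrAC divff ?mul1r// !mulf_neq0.
  have h' : sech_moment b k.*2.+3 = (k.*2.+1%:R ^+ 2 - b ^+ 2) * sech_moment b k.*2.+1 / (4 * k.*2.+1%:R * k.*2.+2%:R) :> R.
    by rewrite E mulrAC divff ?mul1r// !mulf_neq0.
  rewrite h h'; set N1 : R := k.*2.+1%:R; set N2 : R := k.*2.+2%:R.
  have N10 : N1 != 0 by rewrite pnatr_eq0.
  have N20 : N2 != 0 by rewrite pnatr_eq0.
  clearbody N1 N2; by field; rewrite ?N10 ?N20 !gt_eqF.
elim: n => [|n IH].
  (* The cosine order stays two behind: here the factor 1 - b^2 from the first step of [Rrec]
     cancels the denominator of [cos_moment b 1], and each later step cancels (2n+3)^2 - b^2 in the
     same way. *)
  have := @cos_moment1 R 0; rewrite expr0n/= eq_sym oner_eq0 => /(_ isT) c01.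
  have := @cos_moment1 R b; rewrite eq_sym -subr_eq0 -{1}(expr1n _ 2) => /(_ (bk 0%N)) cb1.
  rewrite (Rrec 0%N) cb1 c01 !mul0r cos0 subr0 divr1.
  have := bk 0%N; have := sech_moment_odd_gt0 (R := R) 0; rewrite !expr1n => h0 h1.
  by rewrite divr1; field; rewrite h1 gt_eqF.
rewrite -IH doubleS [in LHS](Rrec n.+1) doubleS.
have := cos_moment_rec b n.*2.+1; have := cos_moment_rec (0 : R) n.*2.+1.
rewrite expr0n/= subr0 => E0 E.
have h : cos_moment 0 n.*2.+3 = n.*2.+2%:R * cos_moment 0 n.*2.+1 / n.*2.+3%:R :> R.
  apply: (@mulfI _ (n.*2.+3%:R ^+ 2)); first by rewrite expf_neq0.
  rewrite E0; set N3 : R := n.*2.+3%:R.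
  have N30 : N3 != 0 by rewrite pnatr_eq0.
  by field.
have h' : cos_moment b n.*2.+3 = n.*2.+3%:R * n.*2.+2%:R * cos_moment b n.*2.+1 / (n.*2.+3%:R ^+ 2 - b ^+ 2).
  by apply: (mulfI (bk n.*2.+2)); rewrite E mulrCA mulfV ?mulr1//; exact: bk.
rewrite h h'.
have c0 := cos_moment0_gt0 (R := R) n.*2.+1.
have A3 := sech_moment_odd_gt0 (R := R) n.+1; rewrite doubleS in A3.
have bn := bk n.*2.+2.
set N3 : R := n.*2.+3%:R in bn *; set N2 : R := n.*2.+2%:R.
have N30 : N3 != 0 by rewrite pnatr_eq0.
have N20 : N2 != 0 by rewrite pnatr_eq0.
clearbody N2 N3; field; rewrite ?bn ?N30 ?N20 !gt_eqF//.
Qed.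

Lemma sech_moment1 b : 0 <= b < 1 -> sech_moment b 1 = pi / (2 * cos (pi * b / 2)).
Proof.
move=> b01; have /andP[b0 b1] := b01; have p0 := @pi_gt0 R.
have cb : 0 < cos (b * pi / 2) by apply: cos_gt0_pihalf; nra.
suff : sech_moment b 1 / sech_moment 0 1 * cos (b * pi / 2) = 1.
  rewrite sech_moment0_1 (mulrC pi b) => E.
  have pn0 : pi != 0 :> R by rewrite gt_eqF.
  transitivity (sech_moment b 1 / (pi / 2) * cos (b * pi / 2) * (pi / (2 * cos (b * pi / 2)))).
    move: pn0 (lt0r_neq0 cb); move: (pi : R) => P pn0 cn0; field.
    by rewrite cn0 pn0.
  by rewrite E mul1r.
set c := LHS; apply/eqP; rewrite -subr_eq0 -normr_eq0 eq_le normr_ge0 andbT.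
apply/ler_addgt0Pr => e0 e00; rewrite add0r.
pose e : R := e0 / 2; have e1 : 0 < e by rewrite divr_gt0.
(* The choice of [k] makes 1/(k e) + 2/k at most e. With the term e of [sech_moment_ratio] the total
   error is 2 e = e0. *)
have [k _ ke] := @nbhs_infty_ger R ((e^-1 + 2) / e).
have {ke} := ke k (leqnn _); rewrite ler_pdivrMr// => ke.
rewrite /c -(sech_cos_moment k b01).
have := @sech_moment_ratio R b k.*2 e b01 e1.
have A3 := sech_moment_odd_gt0 (R := R) k.+1; rewrite doubleS in A3.
move=> /(_ A3).
have := @cos_moment_ratio R b k.*2.+1; rewrite b0 ltW// => /(_ isT) /andP[].
set q := cos_moment b _ / _; set r := sech_moment b _ / _ => q1 q2 r1.
have q0 : 0 <= q.
  by apply: le_trans q1; rewrite subr_ge0 ler_pdivrMr// mul1r ler_nat.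
have -> : r * q - 1 = (r - 1) * q + (q - 1) by ring.
have k1 : k%:R <= k.*2.+1%:R :> R by rewrite ler_nat -addnn -addSn leq_addl.
have k3 : k.*2.+1%:R <= k.*2.+3%:R :> R by rewrite ler_nat 2?leqW.
have kp : 0 < k%:R :> R.
  by rewrite -(pmulr_lgt0 _ e1) (lt_le_trans _ ke)// addr_gt0 ?invr_gt0.
have hh : (k.*2.+1%:R * e)^-1 + 2 / k.*2.+3%:R <= e.
  apply: (@le_trans _ _ ((k%:R * e)^-1 + 2 / k%:R)).
    rewrite lerD//.
      by rewrite lef_pV2 ?posrE ?mulr_gt0// ler_pM2r.
    by rewrite ler_pM2l// lef_pV2 ?posrE// (le_trans k1).
  have -> : (k%:R * e)^-1 + 2 / k%:R = (e^-1 + 2) / k%:R by field; rewrite !gt_eqF.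
  by rewrite ler_pdivrMr// mulrC.
have h1 : `|(r - 1) * q| <= `|r - 1| by rewrite normrM ler_piMr// ger0_norm.
have h2 : `|q - 1| <= 2 / k.*2.+3%:R.
  by rewrite ler0_norm ?subr_le0// opprB lerBlDl addrC -lerBlDl.
rewrite (le_trans (ler_normD _ _))// (le_trans (lerD (le_trans h1 r1) h2))//.
by rewrite -addrA (le_trans (lerD (lexx e) hh))// /e -splitr.
Qed.

End mellin_value.

(** * The Gamma function and the sine integral *)

Section gamma_sine.
Context {R : realType}.
Local Notation mu := (@lebesgue_measure R).
Local Notation Rintegrable D f := (mu.-integrable D (EFin \o f)).
Implicit Types (b x u : R).

Lemma Gamma_continuous b u : 0 < u -> {for u, continuous (fun u => u `^ (b - 1) * expR (- u))}.
Proof. by move=> u0; apply_continuous; deriv. Qed.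

Lemma Gamma_integrable b : 0 < b -> Rintegrable `]0, +oo[ (fun u => u `^ (b - 1) * expR (- u)).
Proof.
move=> b0; pose C := (2 * b) `^ (2 * b).
have C0 : 0 <= C by exact: powR_ge0.
apply: (@Rintegrable_powR_test _ _ b (1 + C)) => //.
- apply: open_continuous_measurable_fun => // x.
  by rewrite inE/= in_itv/= andbT; exact: Gamma_continuous.
- move=> u u0 u1; rewrite ger0_norm ?mulr_ge0 ?powR_ge0 ?expR_ge0//.
  rewrite mulrC ler_wpM2r ?powR_ge0// (@le_trans _ _ 1)//; last by rewrite lerDl.
  by rewrite expR_le1; lra.
- move=> u u1; have u0 : 0 < u by lra.
  rewrite ger0_norm ?mulr_ge0 ?powR_ge0 ?expR_ge0//.
  have -> : u `^ (- b - 1) = u `^ (b - 1) * u `^ (- (2 * b)).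
    rewrite -powRD; last by rewrite (gt_eqF u0) implybT.
    by congr (_ `^ _); ring.
  rewrite mulrCA ler_wpM2l ?powR_ge0//.
  rewrite (@le_trans _ _ (C * u `^ (- (2 * b))))//.
    by apply: expRN_le_powR => //; lra.
  by rewrite ler_wpM2r ?powR_ge0// lerDr.
Qed.

Lemma Gamma_succ b : 0 < b -> Gamma (b + 1) = b * Gamma b.
Proof.
move=> b0; have I1 := Gamma_integrable b0.
have I2 : Rintegrable `]0, +oo[ (fun u => u `^ (b + 1 - 1) * expR (- u)).
  by apply: Gamma_integrable; rewrite addr_gt0.
have I3 : Rintegrable `]0, +oo[ (fun u => b * (u `^ (b - 1) * expR (- u))).
  exact: (@integrableZl _ _ _ mu _ _ b (EFin \o _) I1).
apply/eqP; rewrite -subr_eq0; apply/eqP; rewrite /Gamma.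
rewrite -RintegralZl// -RintegralB// -[RHS](subrr (0 : R)).
pose f u : R := u `^ (b + 1 - 1) * expR (- u) - b * (u `^ (b - 1) * expR (- u)).
pose F u : R := - (u `^ b * expR (- u)).
apply: (@Rintegral_FTC0y _ f F).
- by move=> u u0; rewrite /f; apply_continuous; deriv.
- move=> u u0; rewrite /F /f; apply_is_derive; first by deriv.
  by rewrite /= addrK; ring.
- apply: (@cvg0_le_norm _ _ _ _ F (fun u => u `^ b)); last exact: powR_cvg0.
  near=> u; have u0 : 0 < u by [].
  rewrite normrN ger0_norm ?mulr_ge0 ?powR_ge0 ?expR_ge0//.
  by rewrite ler_piMr ?powR_ge0// expR_le1; lra.
- apply: (@cvg0_le_norm _ _ _ _ F (fun u => (2 * b) `^ (2 * b) * u `^ (- b))); last first.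
    by rewrite -[X in _ --> X](mulr0 ((2 * b) `^ (2 * b))); apply: cvgMr; exact: powRN_cvgy0.
  near=> u; have u0 : 0 < u by near: u; exact: nbhs_pinfty_gt.
  rewrite normrN ger0_norm ?mulr_ge0 ?powR_ge0 ?expR_ge0//.
  have -> : u `^ (- b) = u `^ b * u `^ (- (2 * b)).
    rewrite -powRD; last by rewrite (gt_eqF u0) implybT.
    by congr (_ `^ _); ring.
  by rewrite mulrCA ler_wpM2l ?powR_ge0//; apply: expRN_le_powR => //; lra.
- exact: (@integrableB _ _ _ mu _ _ (EFin \o _) (EFin \o _) I2 I3).
Unshelve. all: by end_near. Qed.

Lemma Rintegral_powR_expR b x : 0 < b -> 0 < x ->
  Rintegrable `]0, +oo[ (fun u => u `^ (b - 1) * expR (- (x * u))) /\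
  \int[mu]_(u in `]0, +oo[) (u `^ (b - 1) * expR (- (x * u))) = x `^ (- b) * Gamma b.
Proof.
move=> b0 x0; have [Ig gE] := Rintegral_scale x0 (Gamma_integrable b0).
pose g u : R := (x * u) `^ (b - 1) * expR (- (x * u)).
have xb : 0 < x `^ (b - 1) by rewrite powR_gt0.
have E u : u \in `]0, +oo[%classic -> u `^ (b - 1) * expR (- (x * u)) = (x `^ (b - 1))^-1 * g u.
  rewrite inE/= in_itv/= andbT => u0; rewrite /g /= powRM ?ltW// mulrA mulrA mulVf ?mul1r// gt_eqF//.
split.
  apply: (@eq_integrable _ _ _ mu _ _ (fun u => ((x `^ (b - 1))^-1 * g u)%:E)) => //.
    by move=> u /E Eu; rewrite /= Eu.
  exact: (@integrableZl _ _ _ mu _ _ _ (EFin \o g)).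
rewrite (eq_Rintegral mu E) RintegralZl// gE -/(Gamma b) mulrA; congr (_ * _).
rewrite -[x^-1]powR_inv1 ?ltW// -powRN -powRD; last by rewrite (gt_eqF x0) implybT.
by congr (_ `^ _); ring.
Qed.

Lemma Rintegral_expR_sin u : 0 < u ->
  Rintegrable `]0, +oo[ (fun x => expR (- (x * u)) * sin x) /\
  \int[mu]_(x in `]0, +oo[) (expR (- (x * u)) * sin x) = (1 + u ^+ 2)^-1.
Proof.
move=> u0; pose f x : R := expR (- (x * u)) * sin x.
have cf x : {for x, continuous f} by rewrite /f; apply_continuous; deriv.
have If : Rintegrable `]0, +oo[ f.
  have [I1 _] := Rintegral_powR_expR ltr01 u0.
  apply: (@le_integrable _ _ _ mu _ _ _ (EFin \o _)) I1 => //.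
    apply/measurable_EFinP; apply: open_continuous_measurable_fun => // x _; exact: cf.
  move=> x _; rewrite /= lee_fin subrr powRr0 mul1r (mulrC u) /f normrM.
  by rewrite ler_piMr ?sin_max.
split => //.
rewrite -[RHS]opprK -sub0r.
pose F x : R := - ((expR (- (x * u)) * (u * sin x + cos x)) * (1 + u ^+ 2)^-1).
have u2 : 0 < 1 + u ^+ 2 by rewrite ltr_pwDl// sqr_ge0.
have dF x : is_derive x 1 F (f x).
  rewrite /F /f; apply_is_derive; first by deriv.
  by rewrite /=; field; rewrite -?expr2 gt_eqF.
apply: (@Rintegral_FTC0y _ f F) => //.
- have -> : - (1 + u ^+ 2)^-1 = F 0.
    by rewrite /F mul0r oppr0 expR0 sin0 cos0 mulr0 add0r !mul1r.
  apply: cvg_at_right_filter; exact: is_derive_continuous (dF 0).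
- pose g x : R := (1 `^ 1 * (u + 1) / (1 + u ^+ 2) * u^-1) * x `^ (- 1).
  apply: (@cvg0_le_norm _ _ _ _ F g); last first.
    by rewrite -[X in _ --> X](mulr0 (1 `^ 1 * (u + 1) / (1 + u ^+ 2) * u^-1)); apply: cvgMr; exact: powRN_cvgy0.
  near=> x; have x0 : 0 < x by near: x; exact: nbhs_pinfty_gt.
  rewrite /F normrN normrM (ger0_norm (_ : 0 <= (1 + u ^+ 2)^-1)) ?invr_ge0 ?(ltW u2)//.
  have h1 : expR (- (x * u)) <= 1 `^ 1 * (u^-1 * x^-1).
    have := @expRN_le_powR R 1 (x * u) ltr01; rewrite mulr_gt0// => /(_ isT).
    by rewrite powR_inv1 ?mulr_ge0 ?(ltW x0) ?(ltW u0)// invfM (mulrC x^-1).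
  have h2 : `|u * sin x + cos x| <= u + 1.
    by rewrite (le_trans (ler_normD _ _))// lerD ?cos_max// normrM gtr0_norm// ler_piMr ?sin_max ?(ltW u0).
  rewrite /g /= powR_inv1 ?(ltW x0)//.
  have -> : 1 `^ 1 * (u + 1) / (1 + u ^+ 2) / u / x =
     (1 `^ 1 * (u^-1 * x^-1)) * (u + 1) * (1 + u ^+ 2)^-1 :> R by ring.
  rewrite ler_wpM2r ?invr_ge0 ?(ltW u2)// normrM ler_pM// ger0_norm ?expR_ge0//.
Unshelve. all: by end_near. Qed.

Definition sine_moment b : R := \int[mu]_(x in `]0, +oo[) (x `^ (- b - 1) * sin x).

Lemma sine_moment_integrable b : 0 < b < 1 -> Rintegrable `]0, +oo[ (fun x => x `^ (- b - 1) * sin x).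
Proof.
(* At infinity the integrand is O(x^(-b-1)), which asks for m <= b. At 0 the bound by |x| on the
   sine leaves x^(-b), which asks for m <= 1 - b. *)
move=> /andP[b0 b1]; pose m := Num.min b (1 - b).
have mb : m <= b by rewrite ge_min lexx.
have mb' : m <= 1 - b by rewrite ge_min lexx orbT.
apply: (@Rintegrable_powR_test _ _ m 1).
- by rewrite lt_min b0 subr_gt0.
- apply: open_continuous_measurable_fun => // x.
  by rewrite inE/= in_itv/= andbT => x0; apply_continuous; deriv.
- move=> x x0 x1; rewrite mul1r normrM (ger0_norm (powR_ge0 _ _)).
  rewrite (@le_trans _ _ (x `^ (- b - 1) * x))//.
    by rewrite ler_wpM2l ?powR_ge0// (le_trans (norm_sin_le _))// gtr0_norm.
  rewrite -[X in _ * X](powRr1 (ltW x0)) -powRD; last by rewrite (gt_eqF x0) implybT.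
  by apply: ger_powR; [rewrite x0|lra].
- move=> x x1; rewrite mul1r normrM (ger0_norm (powR_ge0 _ _)).
  rewrite (@le_trans _ _ (x `^ (- b - 1)))//.
    by rewrite ler_piMr ?powR_ge0// sin_max.
  by apply: ler_powR => //; lra.
Qed.

(* Fubini, with theta^(-b-1) Gamma(b+1) written as a Laplace transform. *)
Lemma Gamma_sine_moment b : 0 < b < 1 -> Gamma (b + 1) * sine_moment b = pi / (2 * cos (pi * b / 2)).
Proof.
move=> b01; have /andP[b0 b1] := b01; have bp : 0 < b + 1 by lra.
have Isin := sine_moment_integrable b01.
rewrite -sech_moment1 ?(ltW b0)//.
pose g x u : R := u `^ (b + 1 - 1) * expR (- (x * u)) * sin x.
have gx x : 0 < x -> \int[mu]_(u in `]0, +oo[) g x u = Gamma (b + 1) * (x `^ (- b - 1) * sin x).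
  move=> x0; have [I1 E1] := Rintegral_powR_expR bp x0.
  by rewrite /g RintegralZr// E1 opprD mulrA (mulrC (Gamma _)).
have gux x u : g x u = u `^ (b + 1 - 1) * (expR (- (x * u)) * sin x) by rewrite /g mulrA.
have gu u : 0 < u -> \int[mu]_(x in `]0, +oo[) g x u = u `^ (b - 1) * sech_exp u ^+ 1.
  move=> u0; have [I1 E1] := Rintegral_expR_sin u0.
  under eq_Rintegral do rewrite gux.
  rewrite RintegralZl// E1 expr1 /sech_exp mulrA; congr (_ / _).
  rewrite -[X in _ = _ * X](powRr1 (ltW u0)) -powRD; last by rewrite (gt_eqF u0) implybT.
  by congr (_ `^ _); ring.
have Ig x : 0 < x -> Rintegrable `]0, +oo[ (g x).
  move=> x0; have [I1 E1] := Rintegral_powR_expR bp x0.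
  exact: (@integrableZr _ _ _ mu _ _ (sin x) (EFin \o _) I1).
rewrite /sine_moment -RintegralZl//.
transitivity (\int[mu]_(x in `]0, +oo[) \int[mu]_(u in `]0, +oo[) g x u).
  by apply: eq_Rintegral => x; rewrite inE/= in_itv/= andbT => x0; rewrite gx.
(* The majorant is the exact inner integral of the absolute value, because only the factor sin x can
   be negative. *)
rewrite (@Rintegral_Fubini _ _ _ _ (fun x => Gamma (b + 1) * (x `^ (- b - 1) * `|sin x|)))//.
- by apply: eq_Rintegral => u; rewrite inE/= in_itv/= andbT => u0; rewrite gu.
- apply: measurable_funM; first apply: measurable_funM.
  + by apply: (@measurableT_comp _ _ _ _ _ _ (fun u : R => u `^ (b + 1 - 1))) => //; exact: measurable_powR.
  + apply: (@measurableT_comp _ _ _ _ _ _ (@expR R)) => //.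
    by apply: measurableT_comp => //; apply: measurable_funM; [exact: measurable_fst|exact: measurable_snd].
  + apply: (@measurableT_comp _ _ _ _ _ _ (@sin R)) => //.
    by apply: continuous_measurable_fun; exact: continuous_sin.
- by move=> x /=; rewrite in_itv/= andbT; exact: Ig.
- move=> u /=; rewrite in_itv/= andbT => u0; have [I1 E1] := Rintegral_expR_sin u0.
  rewrite (_ : g^~ u = fun x => u `^ (b + 1 - 1) * (expR (- (x * u)) * sin x)); last first.
    by apply/funext => x; rewrite gux.
  exact: (@integrableZl _ _ _ mu _ _ _ (EFin \o _) I1).
- move=> x /=; rewrite in_itv/= andbT => x0; have [I1 E1] := Rintegral_powR_expR bp x0.
  under eq_Rintegral => u _ do rewrite /g normrM (ger0_norm (mulr_ge0 (powR_ge0 _ _) (expR_ge0 _))).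
  by rewrite RintegralZr// E1 opprD -mulrA (mulrCA (x `^ _)).
- have Ia := integrable_norm Isin.
  apply: (@eq_integrable _ _ _ mu _ _ (fun x => (Gamma (b + 1) * `|x `^ (- b - 1) * sin x|)%:E)) => //.
    by move=> x _; rewrite /= normrM (ger0_norm (powR_ge0 _ _)).
  exact: (@integrableZl _ _ _ mu _ _ _ (EFin \o _) Ia).
Qed.

Lemma sine_moment_scale b x : 0 < b < 1 -> 0 < x ->
  Rintegrable `]0, +oo[ (fun t => t `^ (- b - 1) * sin (t * x)) /\
  \int[mu]_(t in `]0, +oo[) (t `^ (- b - 1) * sin (t * x)) = x `^ b * sine_moment b.
Proof.
move=> b01 x0; have [Ig gE] := Rintegral_scale x0 (sine_moment_integrable b01).
pose g u : R := (x * u) `^ (- b - 1) * sin (x * u).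
have xb : 0 < x `^ (- b - 1) by rewrite powR_gt0.
have E u : u \in `]0, +oo[%classic -> u `^ (- b - 1) * sin (u * x) = (x `^ (- b - 1))^-1 * g u.
  rewrite inE/= in_itv/= andbT => u0; rewrite /g /= powRM ?ltW// (mulrC u) mulrA mulrA mulVf ?mul1r// gt_eqF//.
split.
  apply: (@eq_integrable _ _ _ mu _ _ (fun u => ((x `^ (- b - 1))^-1 * g u)%:E)) => //.
    by move=> u /E Eu; rewrite /= Eu.
  exact: (@integrableZl _ _ _ mu _ _ _ (EFin \o g)).
rewrite (eq_Rintegral mu E) RintegralZl// gE -/(sine_moment b) mulrA; congr (_ * _).
rewrite -[x^-1]powR_inv1 ?ltW// -powRN -powRD; last by rewrite (gt_eqF x0) implybT.
by congr (_ `^ _); ring.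
Qed.

End gamma_sine.

(** * B-splines and their fractional derivatives *)

Section backward_difference.
Context {R : realType}.
Implicit Types (f g : R -> R) (x : R).

Definition bdiff f x := f x - f (x - 1).

Lemma iter_bdiff_ext n f g : f =1 g -> iter n bdiff f =1 iter n bdiff g.
Proof. by move=> fg; elim: n => //= n IH x; rewrite /bdiff !IH. Qed.

Lemma iter_bdiffZ n f (c : R) x : iter n bdiff (fun y => c * f y) x = c * iter n bdiff f x.
Proof. by elim: n x => //= n IH x; rewrite /bdiff !IH mulrBr. Qed.

Lemma iter_bdiffD n f g x :
  iter n bdiff (fun y => f y + g y) x = iter n bdiff f x + iter n bdiff g x.
Proof. by elim: n x => //= n IH x; rewrite /bdiff !IH; ring. Qed.

(** The discrete Leibniz rule for multiplication by the variable; its shifted term is the source of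
    [bspline q (t - 1)] in the spline recurrence. *)
Lemma iter_bdiff_mulX n f x :
  iter n.+1 bdiff (fun y => y * f y) x =
  x * iter n.+1 bdiff f x + n.+1%:R * iter n bdiff f (x - 1).
Proof.
elim: n x => [|n IH] x; first by rewrite /= /bdiff; ring.
have S k h y : iter k.+1 bdiff h y = iter k bdiff h y - iter k bdiff h (y - 1) by [].
rewrite [LHS]S !IH [X in _ = x * X + _]S.
have -> : n.+2%:R = n.+1%:R + 1 :> R by rewrite natr1.
by rewrite !(S n f (x - 1)); ring.
Qed.

(** Reflection turns backward differences into forward ones, each of which is minus a backward
    difference shifted by 1. This produces the sign and the centre [n%:R / 2]. *)
Lemma iter_bdiff_reflect n f x :
  iter n bdiff f (n%:R - x) = (-1) ^+ n * iter n bdiff (fun y => f (- y)) x.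
Proof.
elim: n x => [|n IH] x; first by rewrite /= sub0r mul1r.
rewrite !iterS /bdiff.
have -> : n.+1%:R - x - 1 = n%:R - x by rewrite -natr1; ring.
have -> : n.+1%:R - x = n%:R - (x - 1) by rewrite -natr1; ring.
by rewrite !IH exprS; ring.
Qed.

Lemma is_derive_iter_bdiff n f f' : (forall x, is_derive x 1 f (f' x)) ->
  forall x, is_derive x 1 (iter n bdiff f) (iter n bdiff f' x).
Proof.
move=> df; elim: n => [|n IH] x //=.
pose g y : R := iter n bdiff f (y - 1).
have dg : is_derive x 1 g (iter n bdiff f' (x - 1)).
  rewrite -[X in is_derive _ _ _ X]mulr1; notypeclasses refine (@deriv_comp _ _ (fun y => y - 1) _ _ _ _ _).
    exact: IH.
  by apply_is_derive; [deriv|rewrite /=; ring].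
exact: (is_deriveB (IH x) dg).
Qed.

(** [P] carries the integrability under which an integral operator [L] may be split over a
    difference. *)
Lemma iter_bdiff_linear (L : (R -> R) -> R -> R) (P : (R -> R) -> Prop) n f :
  (forall f, P f -> P (bdiff f)) ->
  (forall f, P f -> L (bdiff f) =1 bdiff (L f)) -> P f ->
  P (iter n bdiff f) /\ L (iter n bdiff f) =1 iter n bdiff (L f).
Proof.
move=> Pb Lb Pf; elim: n => [|n [Pn IH]] //=; split; first exact: Pb.
by move=> x; rewrite Lb// /bdiff !IH.
Qed.

End backward_difference.

(** * B-splines as iterated differences of truncated powers *)

Section truncated_powers.
Context {R : realType}.
Implicit Types (x y : R).

(** The weak inequality matters for [q = 0] only: it makes the difference of [tpow 0] the indicator
    of [0, 1[ at both endpoints. *)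
Definition tpow (q : nat) y : R := if 0 <= y then y ^+ q / q`!%:R else 0.

(** By induction: [tpow q.+1] is y / (q+1) times [tpow q], and [iter_bdiff_mulX] then reproduces the
    recurrence that defines the spline. *)
Lemma bsplineE q : bspline q =1 iter q.+1 bdiff (tpow q).
Proof.
elim: q => [|q IH] t.
  rewrite /= /bdiff /tpow fact0 !expr0 !divr1 subr_ge0.
  by have [t0|t0] := leP 0 t; have [t1|t1] := ltP t 1 => //=; rewrite ?subr0 ?subrr//; lra.
rewrite [LHS]/= !IH.
have E : tpow q.+1 =1 fun y => q.+1%:R^-1 * (y * tpow q y).
  move=> y; rewrite /tpow; case: ifP => _; last by rewrite !mulr0.
  rewrite factS natrM exprS; set N : R := q.+1%:R; set M : R := q`!%:R.
  have N0 : N != 0 by rewrite pnatr_eq0.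
  have M0 : M != 0 by rewrite pnatr_eq0 -lt0n fact_gt0.
  by clearbody N M; field; rewrite ?N0 ?M0.
rewrite (iter_bdiff_ext _ E) iter_bdiffZ iter_bdiff_mulX.
have Eb : iter q.+2 bdiff (tpow q) t = iter q.+1 bdiff (tpow q) t - iter q.+1 bdiff (tpow q) (t - 1).
  by [].
rewrite Eb; set N : R := q.+1%:R; have -> : q.+2%:R = N + 1 :> R by rewrite natr1.
have N0 : N != 0 by rewrite pnatr_eq0.
clearbody N; field.
exact: N0.
Qed.

Lemma bsplineS q t : bspline q.+1 t =
  t / q.+1%:R * bspline q t + (q.+2%:R - t) / q.+1%:R * bspline q (t - 1) :> R.
Proof. by []. Qed.

(** The induction starts from the hat function, because the half-open indicator [bspline 0] is not
    symmetric at its endpoints. *)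
Lemma bspline_reflect q t : bspline q.+1 (q.+2%:R - t) = bspline q.+1 t :> R.
Proof.
elim: q t => [|q IH] t.
  rewrite !bsplineS /= !divr1.
  have -> : (0 <= 2 - t) = (t <= 2) by lra.
  have -> : (2 - t < 1) = (1 < t) by lra.
  have -> : (0 <= 2 - t - 1) = (t <= 1) by lra.
  have -> : (2 - t - 1 < 1) = (0 < t) by lra.
  have -> : (0 <= t - 1) = (1 <= t) by lra.
  have -> : (t - 1 < 1) = (t < 2) by lra.
  by case: (ltgtP t 0) => h0; case: (ltgtP t 1) => h1; case: (ltgtP t 2) => h2 //=; lra.
rewrite bsplineS [RHS]bsplineS.
have -> : q.+3%:R - t - 1 = q.+2%:R - t by rewrite -[q.+3%:R]natr1; ring.
rewrite IH.
have -> : q.+3%:R - t = q.+2%:R - (t - 1) by rewrite -[q.+3%:R]natr1; ring.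
by rewrite IH addrC; congr (_ + _); congr (_ / _ * _); rewrite -[q.+3%:R]natr1; ring.
Qed.

End truncated_powers.

(** * Truncated powers with real exponent *)

Section truncated_powR.
Context {R : realType}.
Implicit Types (x y a : R).

Definition tpowR a y : R := if 0 < y then y `^ a else 0.

Lemma tpowR_gt0 a y : 0 < y -> tpowR a y = y `^ a.
Proof. by rewrite /tpowR => ->. Qed.

Lemma tpowR_le0 a y : y <= 0 -> tpowR a y = 0.
Proof. by rewrite /tpowR leNgt => /negbTE ->. Qed.

Lemma cvg_norm_powR0 a : 0 < a -> `|h| `^ a @[h --> (0 : R)] --> (0 : R).
Proof.
move=> a0; apply/cvgr0Pnorm_lt => e e0; have ea : 0 < e `^ a^-1 by rewrite powR_gt0.
near=> h.
rewrite ger0_norm ?powR_ge0//.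
have he : `|h| < e `^ a^-1 by near: h; have := @nbhs0_lt R R _ ea; exact.
rewrite -[ltRHS]powRr1 ?(ltW e0)// -(@mulVf _ a) ?gt_eqF// powRrM.
by rewrite gt0_ltr_powR// nnegrE ?powR_ge0.
Unshelve. all: by end_near. Qed.

Lemma is_derive_tpowR_gt0 a x : 0 < x -> is_derive x 1 (tpowR a) (a * x `^ (a - 1)).
Proof.
move=> x0; apply: (@near_eq_is_derive _ _ _ (fun y => y `^ a)) (is_derive1_powR a x0).
by near=> y; rewrite tpowR_gt0//; near: y; exact: (cvgr_gt _ (@cvg_id _ (nbhs x)) _ x0).
Unshelve. all: by end_near. Qed.

Lemma is_derive_tpowR a x : 1 < a -> is_derive x 1 (tpowR a) (a * tpowR (a - 1) x).
Proof.
move=> a1; have [x0|x0|x0] := ltgtP x 0.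
- rewrite tpowR_le0 ?(ltW x0)// mulr0.
  apply: (@near_eq_is_derive _ _ _ (cst 0)) (is_derive_cst _ _ _).
  near=> y; rewrite tpowR_le0//; apply: ltW; near: y; exact: (cvgr_lt _ (@cvg_id _ (nbhs x)) _ x0).
- rewrite tpowR_gt0//; exact: is_derive_tpowR_gt0.
- rewrite x0 tpowR_le0// mulr0.
  (* At 0 the difference quotient is zero on the left and h^(a-1) on the right, which tends to 0
     because a > 1. *)
  have h : h^-1 *: (tpowR a (h *: 1 + 0) - tpowR a 0) @[h --> 0^'] --> (0 : R).
    apply: (@cvg0_le_norm _ _ _ _ _ (fun h : R => `|h| `^ (a - 1))).
      near=> h; have h0 : h != 0 by near: h; exact: nbhs_dnbhs_neq.
      rewrite addr0 (tpowR_le0 _ (lexx 0)) subr0 /GRing.scale/= mulr1.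
      have [hn|hp|e] := ltgtP h 0; last by rewrite e eqxx in h0.
        by rewrite tpowR_le0 ?(ltW hn)// mulr0 normr0 powR_ge0.
      rewrite tpowR_gt0// normrM normfV (gtr0_norm hp) (ger0_norm (powR_ge0 _ _)).
      rewrite -powR_inv1 ?(ltW hp)// -powRD; last by rewrite (gt_eqF hp) implybT.
      by rewrite addrC.
    apply: cvg_within_filter; apply: cvg_norm_powR0; lra.
  apply: DeriveDef; first by apply/cvg_ex; exists 0; exact: h.
  by apply/cvg_lim => //; exact: h.
Unshelve. all: by end_near. Qed.

Lemma continuous_tpowR a : 0 < a -> continuous (tpowR a).
Proof.
move=> a0 x; have [x0|x0|->] := ltgtP x 0.
- have E : \forall y \near x, tpowR a y = 0.
    near=> y; rewrite tpowR_le0//; apply: ltW; near: y; exact: (cvgr_lt _ (@cvg_id _ (nbhs x)) _ x0).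
  rewrite /continuous_at tpowR_le0 ?(ltW x0)//; exact: cvg_near_cst.
- exact: is_derive_continuous (is_derive_tpowR_gt0 a x0).
- rewrite /continuous_at tpowR_le0//.
  apply: (@cvg0_le_norm _ _ _ _ _ (fun h : R => `|h| `^ a)); last exact: cvg_norm_powR0.
  apply: nearW => y; have [y0|y0] := leP y 0; first by rewrite tpowR_le0// normr0 powR_ge0.
  by rewrite tpowR_gt0// (gtr0_norm y0) ger0_norm ?powR_ge0.
Unshelve. all: by end_near. Qed.

End truncated_powR.

(** * Fractional integrals and derivatives of B-splines *)

Section fractional_integral.
Context {R : realType}.
Local Notation mu := (@lebesgue_measure R).
Local Notation Rintegrable D f := (mu.-integrable D (EFin \o f)).
Variable b : R.
Hypothesis b01 : 0 < b < 1.
Implicit Types (f : R -> R) (x : R) (q : nat).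

Let b0 : 0 < b. Proof. by case/andP: b01. Qed.

(* The fractional integral of order b after the substitution y = x - s, without
   the factor 1/Gamma(b). *)
Definition fracint f x : R := \int[mu]_(s in `]0, +oo[) (s `^ (b - 1) * f (x - s)).

Definition fracintegrable f := forall x, Rintegrable `]0, +oo[ (fun s => s `^ (b - 1) * f (x - s)).

Lemma fracintegrable_bdiff f : fracintegrable f -> fracintegrable (bdiff f).
Proof.
move=> If x; rewrite /bdiff.
rewrite (_ : (fun s => _) = fun s => s `^ (b - 1) * f (x - s) - s `^ (b - 1) * f (x - 1 - s)).
  exact: (@integrableB _ _ _ mu _ _ (EFin \o _) (EFin \o _) (If _) (If _)).
by apply/funext => s; rewrite mulrBr; congr (_ - _ * f _); ring.
Qed.

Lemma fracint_bdiff f : fracintegrable f -> fracint (bdiff f) =1 bdiff (fracint f).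
Proof.
move=> If x; rewrite /bdiff /fracint -RintegralB//; [|exact: If..].
by apply: eq_Rintegral => s _; rewrite mulrBr; congr (_ - _ * f _); ring.
Qed.

Lemma measurable_tpow q : measurable_fun setT (@tpow R q).
Proof.
rewrite (_ : tpow q = fun y => y ^+ q / q`!%:R * \1_(`[0, +oo[%classic : set R) y).
  by apply: measurable_funM => //; apply: measurable_funM => //; exact: exprn_measurable.
apply/funext => y; rewrite /tpow indicE mem_setE/= in_itv/= andbT.
by case: ifP; rewrite ?mulr1 ?mulr0.
Qed.

Lemma tpow_lt0 q (y : R) : y < 0 -> tpow q y = 0.
Proof. by rewrite /tpow ltNge => /negbTE ->. Qed.

Lemma tpow_bound q x (s : R) : 0 < s -> `|tpow q (x - s)| <= `|x| ^+ q.
Proof.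
move=> s0; rewrite /tpow; case: ifPn => [xs|_]; last by rewrite normr0 exprn_ge0.
rewrite ger0_norm ?divr_ge0 ?exprn_ge0// ler_pdivrMr ?ltr0n ?fact_gt0//.
rewrite -[leLHS]mulr1 ler_pM ?exprn_ge0// ?ler1n ?fact_gt0//.
by rewrite lerXn2r ?nnegrE// ger0_norm; lra.
Qed.

Lemma fracintegrable_tpow q : fracintegrable (tpow q).
Proof.
move=> x; pose B := `|x| ^+ q; have B0 : 0 <= B by rewrite exprn_ge0.
(* The integrand vanishes for s > x, so on its support s^(b-1) = s^(-b-1) s^(2b) is at most C
   s^(-b-1), the decay that the test requires. *)
pose C := `|x| `^ (2 * b); have C0 : 0 <= C by exact: powR_ge0.
apply: (@Rintegrable_powR_test _ _ b (B * (1 + C))) => //.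
- apply: measurable_funTS; apply: measurable_funM; first exact: measurable_powR.
  apply: (measurableT_comp (measurable_tpow q)); exact: measurable_funB.
- move=> s s0 s1; rewrite normrM (ger0_norm (powR_ge0 _ _)) mulrC ler_wpM2r ?powR_ge0//.
  by rewrite (le_trans (tpow_bound _ _ s0))// ler_peMr// lerDl.
- move=> s s1; have s0 : 0 < s by lra.
  have [xs|xs] := ltP x s.
    by rewrite tpow_lt0 ?subr_lt0// mulr0 normr0 !mulr_ge0 ?powR_ge0// addr_ge0.
  rewrite normrM (ger0_norm (powR_ge0 _ _)).
  have -> : s `^ (b - 1) = s `^ (- b - 1) * s `^ (2 * b).
    rewrite -powRD; last by rewrite (gt_eqF s0) implybT.
    by congr (_ `^ _); ring.
  rewrite -mulrA mulrC ler_wpM2r ?powR_ge0// mulrC ler_pM ?powR_ge0//.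
    exact: tpow_bound.
  rewrite (@le_trans _ _ C)//; last by rewrite lerDr.
  rewrite ge0_ler_powR ?nnegrE ?(ltW s0)//; last by rewrite ger0_norm//; lra.
  by rewrite mulr_ge0// ltW.
Qed.

(** This is Gamma(b) / Gamma(b + q + 1), that is, the Beta integral B(b, q + 1) divided by q!. *)
Definition beta_coef q : R := \prod_(i < q.+1) (b + i%:R)^-1.

Lemma beta_coefS q : beta_coef q.+1 = beta_coef q / (b + q.+1%:R).
Proof. by rewrite /beta_coef big_ord_recr. Qed.

Lemma addbn_gt0 q : 0 < b + q%:R.
Proof. by rewrite ltr_pwDl. Qed.

Lemma fracint_tpow_itv q x : 0 < x ->
  fracint (tpow q) x = \int[mu]_(s in `]0, x[) (s `^ (b - 1) * ((x - s) ^+ q / q`!%:R)).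
Proof.
move=> x0; rewrite /fracint.
have I := @fracintegrable_tpow q x.
have Ix : Rintegrable `]0, x[ (fun s => s `^ (b - 1) * tpow q (x - s)).
  by apply: (integrableS _ _ _ I) => //; apply: subset_itvl.
have := @Rintegral_itvB R (fun s => s `^ (b - 1) * tpow q (x - s)) (BRight 0) +oo%O x I.
rewrite -Rintegral_itv_bndo_bndc// bnd_simp => /(_ (ltW x0) isT) E.
have Z : \int[mu]_(s in `]x, +oo[) (s `^ (b - 1) * tpow q (x - s)) = 0.
  rewrite (@eq_Rintegral _ _ R mu _ (fun=> 0)); first by rewrite Rintegral_cst// mul0r.
  by move=> s; rewrite inE/= in_itv/= andbT => xs; rewrite tpow_lt0 ?mulr0// subr_lt0.
rewrite Z in E; rewrite (subr0_eq E).
apply: eq_Rintegral => s; rewrite inE/= in_itv/= => /andP[_ sx].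
by rewrite /tpow subr_ge0 ltW.
Qed.

Lemma fracint_tpow q x : fracint (tpow q) x = beta_coef q * tpowR (b + q%:R) x.
Proof.
have [x0|x0] := leP x 0.
  rewrite tpowR_le0// mulr0 /fracint (@eq_Rintegral _ _ R mu _ (fun=> 0)); first by rewrite Rintegral_cst// mul0r.
  by move=> s; rewrite inE/= in_itv/= andbT => s0; rewrite tpow_lt0 ?mulr0//; lra.
rewrite tpowR_gt0//; have x0' := ltW x0.
have Ix k : Rintegrable `]0, x[ (fun s => s `^ (b - 1) * ((x - s) ^+ k / k`!%:R)).
  have I := @fracintegrable_tpow k x.
  apply: (@eq_integrable _ _ _ mu _ _ (EFin \o (fun s => s `^ (b - 1) * tpow k (x - s)))) => //.
    move=> s; rewrite inE/= in_itv/= => /andP[_ sx].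
    by rewrite /tpow subr_ge0 ltW.
  by apply: (integrableS _ _ _ I) => //; apply: subset_itvl.
elim: q => [|q IH].
  rewrite fracint_tpow_itv// /beta_coef big_ord1 addr0 -[RHS]subr0.
  pose f s : R := s `^ (b - 1) * ((x - s) ^+ 0 / 0`!%:R).
  pose F s : R := b^-1 * s `^ b.
  have dF (s : R) : 0 < s -> is_derive s 1 F (f s).
    move=> s0; rewrite /F /f; apply_is_derive; first by deriv.
    by rewrite /= expr0 fact0 divr1; field; rewrite gt_eqF.
  apply: (@Rintegral_FTC0o _ f F x) => //.
  + by move=> s /andP[s0 _]; rewrite /f; apply_continuous; deriv.
  + by move=> s /andP[s0 _]; exact: dF.
  + by rewrite -[X in _ --> X](mulr0 b^-1); apply: cvgMr; exact: powR_cvg0.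
  + apply: cvg_at_left_filter; exact: is_derive_continuous (dF _ x0).
  + exact: (Ix 0%N).
have E : (b + q.+1%:R) * fracint (tpow q.+1) x = x * fracint (tpow q) x.
  apply/eqP; rewrite -subr_eq0; apply/eqP; rewrite !fracint_tpow_itv//.
  rewrite -!RintegralZl//.
  have IZ k (a : R) : Rintegrable `]0, x[ (fun s => a * (s `^ (b - 1) * ((x - s) ^+ k / k`!%:R))).
    exact: (@integrableZl _ _ _ mu _ _ a (EFin \o _) (Ix k)).
  rewrite -RintegralB// -[RHS](subrr (0 : R)).
  pose f s : R := (b + q.+1%:R) * (s `^ (b - 1) * ((x - s) ^+ q.+1 / q.+1`!%:R)) -
     x * (s `^ (b - 1) * ((x - s) ^+ q / q`!%:R)).
  (* [F] vanishes at 0 and at x. Writing s = x - (x - s) in its derivative yields the combination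
     [f], hence the Beta recurrence [E]. *)
  pose F s : R := s `^ b * ((x - s) ^+ q.+1 / q.+1`!%:R).
  have f0 : q`!%:R != 0 :> R by rewrite pnatr_eq0 -lt0n fact_gt0.
  have dF (s : R) : 0 < s -> is_derive s 1 F (f s).
    move=> s0; rewrite /F /f; apply_is_derive; first by deriv.
    have -> : s `^ b = s * s `^ (b - 1).
      rewrite -{2}[s]powRr1 ?(ltW s0)// -powRD; last by rewrite (gt_eqF s0) implybT.
      by congr (_ `^ _); ring.
    rewrite /= factS natrM exprS.
    have : q.+1%:R != 0 :> R by rewrite pnatr_eq0.
    move: (q.+1%:R : R) (q`!%:R : R) f0 => N M M0 N0.
    by field; rewrite M0 N0.
  apply: (@Rintegral_FTC0o _ f F x) => //.
  + by move=> s /andP[s0 _]; rewrite /f; apply_continuous; deriv.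
  + by move=> s /andP[s0 _]; exact: dF.
  + apply: (@cvg0_le_norm _ _ _ _ F (fun s => x ^+ q.+1 * s `^ b)); last first.
      by rewrite -[X in _ --> X](mulr0 (x ^+ q.+1)); apply: cvgMr; exact: powR_cvg0.
    near=> s; have s0 : 0 < s by [].
    have sx : s <= x by near: s; exact: nbhs_right_le.
    rewrite /F normrM (ger0_norm (powR_ge0 _ _)) mulrC ler_wpM2r ?powR_ge0//.
    have := @tpow_bound q.+1 x s s0; rewrite /tpow subr_ge0 sx => /le_trans; apply.
    by rewrite ger0_norm.
  + have -> : 0 = F x by rewrite /F subrr expr0n mul0r mulr0.
    apply: cvg_at_left_filter; exact: is_derive_continuous (dF _ x0).
  + exact: (@integrableB _ _ _ mu _ _ (EFin \o _) (EFin \o _) (IZ _ _) (IZ _ _)).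
have bq := addbn_gt0 q.+1.
apply: (@mulfI _ (b + q.+1%:R)); first by rewrite gt_eqF.
rewrite E IH beta_coefS.
have -> : x `^ (b + q.+1%:R) = x * x `^ (b + q%:R).
  rewrite -{2}[x]powRr1// -powRD; last by rewrite (gt_eqF x0) implybT.
  by congr (_ `^ _); rewrite -natr1; ring.
by move: bq; move: (q.+1%:R : R) => N bN; field; rewrite gt_eqF.
Unshelve. all: by end_near. Qed.

Lemma fracint_bspline q : fracintegrable (bspline q) /\
  fracint (bspline q) =1 iter q.+1 bdiff (fun y => beta_coef q * tpowR (b + q%:R) y).
Proof.
have E : bspline q = iter q.+1 bdiff (@tpow R q) by apply/funext => t; exact: bsplineE.
have [] := @iter_bdiff_linear R fracint fracintegrable q.+1 (tpow q) fracintegrable_bdiff fracint_bdiff (fracintegrable_tpow q).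
rewrite -E => I J; split => // x; rewrite J; apply: iter_bdiff_ext => y; exact: fracint_tpow.
Qed.

(** With this normalization differentiation only lowers the index. The exponent b + q + 1 exceeds 1,
    so the derivative exists at 0 as well. *)
Lemma is_derive_beta_tpowR q x :
  is_derive x 1 (fun y => beta_coef q.+1 * tpowR (b + q.+1%:R) y) (beta_coef q * tpowR (b + q%:R) x).
Proof.
have bq := addbn_gt0 q.+1.
have := @is_derive_tpowR R (b + q.+1%:R) x; rewrite ltr_pwDl ?ler1n// => /(_ isT) d.
apply_is_derive; first by deriv1; [deriv|exact: d].
rewrite /= beta_coefS mulr0 addr0.
have -> : b + q.+1%:R - 1 = b + q%:R by rewrite -natr1; ring.
by move: bq; move: (q.+1%:R : R) => N bN; field; rewrite gt_eqF.
Qed.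

(** Here p = q + 2: the order of differencing is p + 1 and the exponent b + q is p - alpha. This is
    the second derivative of [fracint (bspline q.+2)], so the left fractional derivative times
    Gamma(b). *)
Definition fracderiv q : R -> R := iter q.+3 bdiff (fun y => beta_coef q * tpowR (b + q%:R) y).

Lemma derive1n2 f f' f'' : (forall x, is_derive x 1 f (f' x)) ->
  (forall x, is_derive x 1 f' (f'' x)) -> derive1n 2 f = f''.
Proof.
move=> d1 d2; have E1 : derive1 f = f' by apply/funext => x; rewrite derive1E; case: (d1 x).
by rewrite /derive1n /= E1; apply/funext => x; rewrite derive1E; case: (d2 x).
Qed.

Let df1 q x : is_derive x 1 (fracint (bspline q.+2))
   (iter q.+3 bdiff (fun y => beta_coef q.+1 * tpowR (b + q.+1%:R) y) x).
Proof.
have [_ /funext ->] := fracint_bspline q.+2.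
by apply: is_derive_iter_bdiff => y; exact: is_derive_beta_tpowR.
Qed.

Let df2 q x : is_derive x 1 (iter q.+3 bdiff (fun y => beta_coef q.+1 * tpowR (b + q.+1%:R) y))
  (fracderiv q x).
Proof. by apply: is_derive_iter_bdiff => y; exact: is_derive_beta_tpowR. Qed.

Lemma left_integralE f x : fracintegrable f ->
  \int[mu]_(y in `]-oo, x[) ((x - y) `^ (b - 1) * f y) = fracint f x.
Proof.
move=> If; have n1 : (-1 : R) != 0 by [].
rewrite /fracint (@Rintegral_affine _ (-1) x _ _ n1 _ (If x))//.
rewrite normrN1 mul1r (_ : _ @^-1` _ = `]-oo, x[%classic); last first.
  by apply/seteqP; split => y /=; rewrite !in_itv/= ?andbT; lra.
apply: eq_Rintegral => y _.
have -> : -1 * y + x = x - y by ring.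
by rewrite subKr.
Qed.

(** Symmetry of the spline turns the right-sided integral at x into the left-sided one at p + 1 - x,
    so only one of them needs computing. *)
Lemma right_integralE q x :
  \int[mu]_(y in `]x, +oo[) ((y - x) `^ (b - 1) * bspline q.+2 y) =
  fracint (bspline q.+2) (q.+3%:R - x).
Proof.
have [If _] := fracint_bspline q.+2.
have n1 : (1 : R) != 0 by [].
rewrite /fracint (@Rintegral_affine _ 1 (- x) _ _ n1 _ (If _))//.
rewrite normr1 mul1r (_ : _ @^-1` _ = `]x, +oo[%classic); last first.
  by apply/seteqP; split => y /=; rewrite !in_itv/= ?andbT; lra.
apply: eq_Rintegral => y _; rewrite mul1r; congr (_ * _).
by rewrite -bspline_reflect; congr (bspline _ _); ring.
Qed.

Lemma derive2_left q : derive1n 2 (fun x => \int[mu]_(y in `]-oo, x[)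
   ((x - y) `^ (b - 1) * bspline q.+2 y)) = fracderiv q.
Proof.
have [If _] := fracint_bspline q.+2.
rewrite (_ : (fun x => _) = fracint (bspline q.+2)); first exact: derive1n2 (df1 q) (df2 q).
by apply/funext => x; exact: left_integralE.
Qed.

Lemma derive2_right q : derive1n 2 (fun x => \int[mu]_(y in `]x, +oo[)
   ((y - x) `^ (b - 1) * bspline q.+2 y)) = (fun x => fracderiv q (q.+3%:R - x)).
Proof.
rewrite (_ : (fun x => _) = (fun x => fracint (bspline q.+2) (q.+3%:R - x))); last first.
  by apply/funext => x; exact: right_integralE.
have dc (x : R) : is_derive x 1 (fun y : R => q.+3%:R - y) (-1).
  by apply_is_derive; [deriv|rewrite /=; ring].
apply: (@derive1n2 _ (fun x => - iter q.+3 bdiff (fun y => beta_coef q.+1 * tpowR (b + q.+1%:R) y) (q.+3%:R - x))) => x.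
- by rewrite -mulrN1; exact: (deriv_comp (df1 q _) (dc x)).
- rewrite (_ : fracderiv q _ = - (fracderiv q (q.+3%:R - x) * -1)); last by rewrite mulrN1 opprK.
  by notypeclasses refine (derivN _); exact: (deriv_comp (df2 q _) (dc x)).
Qed.

End fractional_integral.

(** * Fourier representation *)

Section fourier_representation.
Context {R : realType}.
Local Notation mu := (@lebesgue_measure R).
Local Notation Rintegrable D f := (mu.-integrable D (EFin \o f)).
Variable b : R.
Hypothesis b01 : 0 < b < 1.
Implicit Types (x t : R) (q n : nat).

Let b0 : 0 < b. Proof. by case/andP: b01. Qed.
Let b1 : b < 1. Proof. by case/andP: b01. Qed.

Lemma Rintegral_iter_bdiff D (g : R -> R -> R) n : measurable D ->
  (forall y, Rintegrable D (fun t => g t y)) -> forall x,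
  Rintegrable D (fun t => iter n bdiff (g t) x) /\
  \int[mu]_(t in D) iter n bdiff (g t) x = iter n bdiff (fun y => \int[mu]_(t in D) g t y) x.
Proof.
move=> mD Ig; elim: n => [|n IH] x; first by split=> //; exact: Ig.
have [I1 E1] := IH x; have [I2 E2] := IH (x - 1); split.
  exact: (@integrableB _ _ _ mu _ mD (EFin \o _) (EFin \o _) I1 I2).
by rewrite /= {1}/bdiff RintegralB// E1 E2.
Qed.

Lemma sinBsin x t (c : R) :
  sin (t * (x - c)) - sin (t * (x - 1 - c)) = 2 * sin (t / 2) * cos (t * (x - (c + 2^-1))).
Proof.
have -> : t * (x - c) = t * (x - (c + 2^-1)) + t / 2 by field.
have -> : t * (x - 1 - c) = t * (x - (c + 2^-1)) - t / 2 by field.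
by rewrite sinD sinB; ring.
Qed.

Lemma cosBcos x t (c : R) :
  cos (t * (x - c)) - cos (t * (x - 1 - c)) = - (2 * sin (t / 2)) * sin (t * (x - (c + 2^-1))).
Proof.
have -> : t * (x - c) = t * (x - (c + 2^-1)) + t / 2 by field.
have -> : t * (x - 1 - c) = t * (x - (c + 2^-1)) - t / 2 by field.
by rewrite cosD cosB; ring.
Qed.

(** A backward difference multiplies exp (i t y) by 2 i sin (t/2) exp (- i t/2). Three of them give
    i^3 = - i, which turns the sine into minus a cosine and moves the centre to 3/2. *)
Lemma iter_bdiff3_sin t x :
  iter 3 bdiff (fun y => sin (t * y)) x = - (2 * sin (t / 2)) ^+ 3 * cos (t * (x - 3 / 2)).
Proof.
have E1 : bdiff (fun y => sin (t * y)) =1 fun y => (2 * sin (t / 2)) * cos (t * (y - 2^-1)).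
  move=> y; have := sinBsin y t 0; rewrite !subr0 add0r; exact.
have E2 : bdiff (fun y => (2 * sin (t / 2)) * cos (t * (y - 2^-1))) =1
    fun y => - (2 * sin (t / 2)) ^+ 2 * sin (t * (y - 1)).
  move=> y; rewrite /bdiff -mulrBr cosBcos.
  have -> : 2^-1 + 2^-1 = 1 :> R by field.
  by ring.
rewrite iterSr (iter_bdiff_ext _ E1) iterSr (iter_bdiff_ext _ E2) /= /bdiff.
rewrite -mulrBr sinBsin (_ : 1 + 2^-1 = 3 / 2); last by field.
by ring.
Qed.

Definition sinc_weight q t : R := t `^ (2 - b) * (sin (t / 2) / (t / 2)) ^+ q.+3.

Lemma norm_sinc_le1 t : 0 < t -> `|sin (t / 2) / (t / 2)| <= 1.
Proof.
move=> t0; have t2 : 0 < t / 2 by rewrite divr_gt0.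
rewrite normrM normfV (gtr0_norm t2) ler_pdivrMr// mul1r.
by rewrite (le_trans (norm_sin_le _))// gtr0_norm.
Qed.

Lemma norm_sinc_leV t : 0 < t -> `|sin (t / 2) / (t / 2)| <= 2 / t.
Proof.
move=> t0; have t2 : 0 < t / 2 by rewrite divr_gt0.
by rewrite normrM normfV (gtr0_norm t2) invf_div ler_piMl ?sin_max// divr_ge0// ltW.
Qed.

Lemma measurable_invr : measurable_fun setT (fun t : R => t^-1).
Proof.
(* The square makes the base nonnegative, where the power -1 is the inverse; at 0 both sides are
   0. *)
rewrite (_ : (fun t => _) = fun t : R => t * (t ^+ 2) `^ (-1)).
  apply: measurable_funM => //.
  apply: (@measurableT_comp _ _ _ _ _ _ (fun y : R => y `^ (-1))); first exact: measurable_powR.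
  exact: exprn_measurable.
apply/funext => t; rewrite powR_inv1 ?sqr_ge0//.
by have [->|t0] := eqVneq t 0; [rewrite mul0r invr0|field].
Qed.

Lemma measurable_sinc_weight q : measurable_fun setT (sinc_weight q).
Proof.
apply: measurable_funM; first exact: measurable_powR.
apply: (@measurableT_comp _ _ _ _ _ _ (fun y : R => y ^+ q.+3)); first exact: exprn_measurable.
have m2 : measurable_fun setT (fun t : R => t / 2) by exact: measurable_funM.
apply: measurable_funM.
  apply: (@measurableT_comp _ _ _ _ _ _ (@sin R)) => //.
  by apply: continuous_measurable_fun; exact: continuous_sin.
rewrite (_ : (fun t => _) = fun t => 2 * t^-1); last first.
  by apply/funext => t; rewrite invf_div.
by apply: measurable_funM => //; exact: measurable_invr.
Qed.

Lemma norm_sinc_weight_le1 q t : 0 < t -> `|sinc_weight q t| <= t `^ (2 - b).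
Proof.
move=> t0; rewrite /sinc_weight normrM (ger0_norm (powR_ge0 _ _)) ler_piMr ?powR_ge0//.
by rewrite normrX exprn_ile1// norm_sinc_le1.
Qed.

(** Three of the factors are bounded by 2 / t, whence 8 = 2^3, and the other q by 1; the bound is
    uniform in q. *)
Lemma norm_sinc_weight_leV q t : 0 < t -> `|sinc_weight q t| <= 8 * t `^ (- b - 1).
Proof.
move=> t0; rewrite /sinc_weight normrM (ger0_norm (powR_ge0 _ _)).
have -> : t `^ (- b - 1) = t `^ (2 - b) * t^-1 ^+ 3.
  rewrite exprVn -powR_invn ?ltW// -powRD; last by rewrite (gt_eqF t0) implybT.
  by congr (_ `^ _); ring.
rewrite mulrCA ler_wpM2l ?powR_ge0//.
have -> : 8 * t^-1 ^+ 3 = (2 / t) ^+ 3 by rewrite exprMn; ring.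
rewrite normrX (_ : q.+3 = (3 + q)%N)// exprD (@le_trans _ _ (`|sin (t / 2) / (t / 2)| ^+ 3))//.
  by rewrite ler_piMr ?exprn_ge0// exprn_ile1// norm_sinc_le1.
by rewrite lerXn2r ?nnegrE// ?norm_sinc_leV// divr_ge0// ltW.
Qed.

Lemma sinc_weight_integrable q : Rintegrable `]0, +oo[ (sinc_weight q).
Proof.
apply: (@Rintegrable_powR_test _ _ b 8) => //.
- apply: measurable_funTS; exact: measurable_sinc_weight.
- move=> t t0 t1; rewrite (le_trans (norm_sinc_weight_le1 _ t0))//.
  rewrite (@le_trans _ _ (t `^ (b - 1)))//; last by rewrite ler_peMl ?powR_ge0// (ler_nat _ 1 8).
  by apply: ger_powR; [rewrite t0|have := b1; have := b0; lra].
- by move=> t t1; apply: norm_sinc_weight_leV; lra.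
Qed.

Lemma sinc_weight_mul_integrable q (c : R -> R) : measurable_fun setT c -> (forall t, `|c t| <= 1) ->
  Rintegrable `]0, +oo[ (fun t => sinc_weight q t * c t).
Proof.
move=> mc c1.
apply: (@le_integrable _ _ _ mu _ _ _ (EFin \o sinc_weight q)) (sinc_weight_integrable q) => //.
  apply/measurable_EFinP; apply: measurable_funTS; apply: measurable_funM => //.
  exact: measurable_sinc_weight.
by move=> t _; rewrite /= lee_fin normrM ler_piMr.
Qed.

Definition sinc_transform q x : R := \int[mu]_(t in `]0, +oo[) (sinc_weight q t * cos (t * (x - q.+3%:R / 2))).

Lemma measurable_cosM x : measurable_fun setT (fun t : R => cos (t * x)).
Proof.
apply: (@measurableT_comp _ _ _ _ _ _ (@cos R)) => //.
  by apply: continuous_measurable_fun; exact: continuous_cos.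
exact: measurable_funM.
Qed.

(** The sign comes from reflecting q + 3 differences, and it alternates so that each function is the
    derivative of the next. For q = 0 this is |x|^b sgn x / b. *)
Definition sym_tpowR q x : R := beta_coef b q * (tpowR (b + q%:R) x + (-1) ^+ q.+3 * tpowR (b + q%:R) (- x)).

Lemma fracderiv_sym q x : fracderiv b q x + fracderiv b q (q.+3%:R - x) = iter q.+3 bdiff (sym_tpowR q) x.
Proof.
rewrite /fracderiv iter_bdiff_reflect -[(-1) ^+ _ * _]iter_bdiffZ -iter_bdiffD.
by apply: iter_bdiff_ext => y; rewrite /sym_tpowR; ring.
Qed.

Lemma is_derive_sym_tpowR q x : is_derive x 1 (sym_tpowR q.+1) (sym_tpowR q x).
Proof.
pose f y : R := beta_coef b q.+1 * tpowR (b + q.+1%:R) y.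
have df (y : R) : is_derive y 1 f (beta_coef b q * tpowR (b + q%:R) y) by exact: is_derive_beta_tpowR.
have E : sym_tpowR q.+1 = fun y => f y + (-1) ^+ q.+4 * f (- y).
  by apply/funext => y; rewrite /sym_tpowR /f; ring.
have dN : is_derive x 1 (fun y => f (- y)) (beta_coef b q * tpowR (b + q%:R) (- x) * -1).
  by notypeclasses refine (deriv_comp (df _) _); exact: is_deriveNid.
rewrite E; notypeclasses refine (is_derive_eq _ _).
  notypeclasses refine (derivD (df x) _); notypeclasses refine (derivM _ dN); deriv.
by rewrite /sym_tpowR [(-1) ^+ q.+4]exprS /=; ring.
Qed.

Lemma continuous_sym_tpowR q : continuous (sym_tpowR q).
Proof.
case: q => [|q] x; last exact: is_derive_continuous (is_derive_sym_tpowR q x).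
rewrite /sym_tpowR addr0.
have ct := @continuous_tpowR R b b0.
apply: cvgMr; apply: cvgD; first exact: ct.
apply: cvgMr; apply: continuous_comp; last exact: ct.
exact: oppr_continuous.
Qed.

Lemma continuous_iter_bdiff n (f : R -> R) : continuous f -> continuous (iter n bdiff f).
Proof.
move=> cf; elim: n => [|n IH] //= x; rewrite /bdiff.
apply: cvgB; first exact: IH.
have cx : (fun y : R => y - 1) @ x --> x - 1 by apply: cvgB => //; exact: cvg_cst.
exact: (cvg_comp _ _ cx (IH (x - 1))).
Qed.

(** The odd extension of [sine_moment_scale] to all real x; the factor b undoes [beta_coef b 0],
    which is 1/b. *)
Lemma sine_moment_sym x :
  Rintegrable `]0, +oo[ (fun t => t `^ (- b - 1) * sin (t * x)) /\
  \int[mu]_(t in `]0, +oo[) (t `^ (- b - 1) * sin (t * x)) = sine_moment b * (b * sym_tpowR 0 x).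
Proof.
have E0 y : b * sym_tpowR 0 y = tpowR b y - tpowR b (- y).
  rewrite /sym_tpowR /beta_coef big_ord1 addr0 mulVKf ?gt_eqF//.
  by rewrite !exprS expr0; ring.
rewrite E0; have [x0|x0|->] := ltgtP x 0.
- have xN : 0 < - x by rewrite oppr_gt0.
  have [I1 E1] := sine_moment_scale b01 xN.
  have E t : t `^ (- b - 1) * sin (t * x) = - 1 * (t `^ (- b - 1) * sin (t * - x)).
    by rewrite mulrN sinN; ring.
  split.
    rewrite (_ : (fun t => _) = fun t => - 1 * (t `^ (- b - 1) * sin (t * - x))); last exact/funext.
    exact: (@integrableZl _ _ _ mu _ _ _ (EFin \o _) I1).
  under eq_Rintegral do rewrite E.
  by rewrite RintegralZl// E1 tpowR_le0 ?(ltW x0)// tpowR_gt0//; ring.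
- have [I1 E1] := sine_moment_scale b01 x0; split => //.
  by rewrite E1 tpowR_gt0// tpowR_le0 ?oppr_le0 ?(ltW x0)//; ring.
- split.
    rewrite (_ : (fun t => _) = cst 0); last by apply/funext => t; rewrite mulr0 sin0 mulr0.
    exact: integrable0.
  under eq_Rintegral do rewrite mulr0 sin0 mulr0.
  by rewrite Rintegral_cst// mul0r oppr0 subrr mulr0.
Qed.

Lemma sinc_transformE q x :
  sine_moment b * (b * iter q.+3 bdiff (sym_tpowR q) x) = - sinc_transform q x.
Proof.
elim: q x => [|q IH] x.
  have Ig y : Rintegrable `]0, +oo[ (fun t => t `^ (- b - 1) * sin (t * y)) by have [] := sine_moment_sym y.
  rewrite -!iter_bdiffZ.
  rewrite (iter_bdiff_ext _ (g := fun y => \int[mu]_(t in `]0, +oo[) (t `^ (- b - 1) * sin (t * y)))); last first.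
    by move=> y; have [_ ->] := sine_moment_sym y.
  have [I <-] := @Rintegral_iter_bdiff _ (fun t y => t `^ (- b - 1) * sin (t * y)) 3 (measurable_itv _) Ig x.
  rewrite /sinc_transform -[RHS]mulN1r -RintegralZl//; last first.
    by apply: sinc_weight_mul_integrable; [exact: measurable_cosM|move=> t; exact: cos_max].
  apply: eq_Rintegral => t; rewrite inE/= in_itv/= andbT => t0.
  transitivity (t `^ (- b - 1) * iter 3 bdiff (fun y => sin (t * y)) x).
    exact: (@iter_bdiffZ R 3 (fun y => sin (t * y)) (t `^ (- b - 1)) x).
  rewrite iter_bdiff3_sin /sinc_weight.
  have -> : t `^ (- b - 1) = t `^ (2 - b) * t ^- 3.
    rewrite -powR_invn ?ltW// -powRD; last by rewrite (gt_eqF t0) implybT.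
    by congr (_ `^ _); ring.
  by field; rewrite gt_eqF.
have E : iter q.+4 bdiff (sym_tpowR q.+1) x = \int[mu]_(s in `[x - 1, x]) iter q.+3 bdiff (sym_tpowR q) s.
  apply: esym; apply: (@Rintegral_FTC _ _ (iter q.+3 bdiff (sym_tpowR q.+1)) (x - 1) x).
  - lra.
  - by move=> s _; apply: continuous_iter_bdiff; exact: continuous_sym_tpowR.
  - by move=> s _; apply: is_derive_iter_bdiff => y; exact: is_derive_sym_tpowR.
have Iw s : Rintegrable `]0, +oo[ (fun t => sinc_weight q t * cos (t * (s - q.+3%:R / 2))).
  by apply: sinc_weight_mul_integrable; [exact: measurable_cosM|move=> t; exact: cos_max].
have cI : Rintegrable `[x - 1, x] (iter q.+3 bdiff (sym_tpowR q)).
  by apply: Rintegrable_itvcc; apply: continuous_iter_bdiff; exact: continuous_sym_tpowR.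
have cIb : Rintegrable `[x - 1, x] (fun s => b * iter q.+3 bdiff (sym_tpowR q) s).
  exact: (@integrableZl _ _ _ mu _ _ _ (EFin \o _) cI).
rewrite E -RintegralZl// -RintegralZl//.
under eq_Rintegral do rewrite IH -mulN1r.
have ccos t : continuous (fun s : R => cos (t * (s - q.+3%:R / 2))).
  by move=> s; apply_continuous; deriv.
have F : \int[mu]_(s in `[x - 1, x]) sinc_transform q s = sinc_transform q.+1 x.
  rewrite /sinc_transform (@Rintegral_Fubini _ _ _ _ (fun=> \int[mu]_(t in `]0, +oo[) `|sinc_weight q t|))//.
  - apply: eq_Rintegral => t; rewrite inE/= in_itv/= andbT => t0.
    rewrite RintegralZl//; last exact: Rintegrable_itvcc.
    pose S s : R := t^-1 * sin (t * (s - q.+3%:R / 2)).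
    have -> : \int[mu]_(s in `[x - 1, x]) cos (t * (s - q.+3%:R / 2)) = S x - S (x - 1).
      apply: Rintegral_FTC; first lra.
      - by move=> s _; exact: ccos.
      - move=> s _; rewrite /S; apply_is_derive; first by deriv.
        by rewrite /=; field; rewrite gt_eqF.
    rewrite /S -mulrBr sinBsin /sinc_weight [_ ^+ q.+4]exprS.
    have -> : q.+3%:R / 2 + 2^-1 = q.+4%:R / 2 :> R by rewrite -[q.+4%:R]natr1; field.
    move: (cos _) (sin _) (_ ^+ q.+3) (t `^ _) => c s' w r.
    by field; rewrite gt_eqF.
  - apply: measurable_funM.
      by apply: (measurableT_comp (measurable_sinc_weight q)); exact: measurable_snd.
    apply: (@measurableT_comp _ _ _ _ _ _ (@cos R)) => //.
      by apply: continuous_measurable_fun; exact: continuous_cos.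
    apply: measurable_funM; first exact: measurable_snd.
    by apply: measurable_funB => //; exact: measurable_fst.
  - move=> t _; apply: (@Rintegrable_itvcc _ (fun s => sinc_weight q t * cos (t * (s - q.+3%:R / 2)))).
    by move=> s; apply: cvgMr; exact: ccos.
  - move=> s _; apply: le_Rintegral => //.
    + exact: integrable_norm (Iw s).
    + exact: integrable_norm (sinc_weight_integrable q).
    + by move=> t _; rewrite normrM ler_piMr// cos_max.
  - by apply: Rintegrable_itvcc => s; exact: cvg_cst.
rewrite RintegralZl ?F ?mulN1r//.
(* Integrability of [sinc_transform q] over the interval is read off from [IH], which identifies it
   up to sign with this continuous function. *)
have cIK : Rintegrable `[x - 1, x] (fun s => sine_moment b * (b * iter q.+3 bdiff (sym_tpowR q) s)).
  exact: (@integrableZl _ _ _ mu _ _ _ (EFin \o _) cIb).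
apply: (@eq_integrable _ _ _ mu _ _ (fun s => ((-1) * (sine_moment b * (b * iter q.+3 bdiff (sym_tpowR q) s)))%:E)) => //.
  by move=> s _; rewrite IH mulN1r opprK.
exact: (@integrableZl _ _ _ mu _ _ _ (EFin \o _) cIK).
Qed.

End fourier_representation.

(** * Fourier coefficients of the periodized symbol *)

Section periodization.
Context {R : realType}.
Local Notation mu := (@lebesgue_measure R).
Local Notation Rintegrable D f := (mu.-integrable D (EFin \o f)).

Lemma cvg_Rintegral_dominated (D : set R) (f_ : nat -> R -> R) (f h : R -> R) :
  measurable D -> (forall n, measurable_fun D (f_ n)) ->
  (forall x, D x -> f_ n x @[n --> \oo] --> f x) ->
  (forall n x, D x -> `|f_ n x| <= h x) -> Rintegrable D h ->
  \int[mu]_(x in D) f_ n x @[n --> \oo] --> \int[mu]_(x in D) f x.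
Proof.
move=> mD mf ff fh ih.
have mh : measurable_fun D h by apply/measurable_EFinP; exact: measurable_int ih.
have If n : Rintegrable D (f_ n).
  apply: (@le_integrable _ _ _ mu _ mD _ (EFin \o h)) ih; first by apply/measurable_EFinP; exact: mf.
  by move=> x Dx; rewrite /= lee_fin (le_trans (fh _ _ Dx))// ler_norm.
have mf' : measurable_fun D f.
  by apply: (measurable_fun_cvg mf) => x Dx; exact: ff.
have [] := @dominated_convergence _ _ R mu D mD (fun n => EFin \o f_ n) (EFin \o f) (EFin \o h).
- by move=> n; apply/measurable_EFinP; exact: mf.
- by apply/measurable_EFinP.
- by apply: aeW => x Dx; apply: cvg_EFin; [exact: nearW|exact: ff].
- exact: ih.
- by apply: aeW => x n Dx; rewrite /= lee_fin fh.
move=> I _ cv; apply: fine_cvg; rewrite /Rintegral fineK//.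
exact: integrable_fin_num.
Qed.

(** The mean value theorem in the role of the integral test: it bounds the terms of a convergent
    series by telescoping differences. *)
Lemma powRN_sub_ge (s y : R) : 0 < s -> 0 < y ->
  s * (y + 1) `^ (- s - 1) <= y `^ (- s) - (y + 1) `^ (- s).
Proof.
move=> s0 y0; have yy : y < y + 1 by rewrite ltrDl.
have d (t : R) : 0 < t -> is_derive t 1 (fun t => t `^ (- s)) (- s * t `^ (- s - 1)).
  by move=> t0; exact: is_derive1_powR.
have di (t : R) : t \in `]y, y + 1[ -> is_derive t 1 (fun t => t `^ (- s)) (- s * t `^ (- s - 1)).
  by rewrite in_itv/= => /andP[yt _]; apply: d; exact: (lt_trans y0 yt).
have cf : {within `[y, y + 1], continuous (fun t : R => t `^ (- s))}.
  apply: continuous_in_subspaceT => t; rewrite inE/= in_itv/= => /andP[yt _].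
  exact: is_derive_continuous (d _ (lt_le_trans y0 yt)).
have [c] := MVT yy di cf; rewrite in_itv/= => /andP[yc cy].
rewrite addrAC subrr add0r mulr1 => E.
have c0 := lt_trans y0 yc.
rewrite -[leRHS]opprB E mulNr opprK ler_wpM2l ?(ltW s0)//.
rewrite -!opprD !powRN lef_pV2 ?posrE ?powR_gt0 ?addr_gt0//.
by rewrite ge0_ler_powR ?nnegrE ?(ltW c0) ?(ltW cy)//; lra.
Qed.

Variable b : R.
Hypothesis b01 : 0 < b < 1.
Variable q : nat.

Let b0 : 0 < b. Proof. by case/andP: b01. Qed.
Let b1 : b < 1. Proof. by case/andP: b01. Qed.

(* The term l = 0 of f^{p,alpha}, with p = q + 2; the term l is its translate. *)
Definition sinc_bump (t : R) : R := `|t| `^ (2 - b) * (sin (t / 2) / (t / 2)) ^+ q.+3.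

Lemma ftermE (t : R) (l : int) : fterm q.+2 (2 - b) t l = sinc_bump (t + 2 * l%:~R * pi).
Proof.
rewrite /fterm /sinc_bump (_ : (t + 2 * l%:~R * pi) / 2 = t / 2 + l%:~R * pi)//.
by field.
Qed.

Lemma sinc_bumpN t : sinc_bump (- t) = sinc_bump t.
Proof. by rewrite /sinc_bump normrN mulNr sinN invrN mulrNN. Qed.

Lemma sinc_bump_gt0 t : 0 < t -> sinc_bump t = sinc_weight b q t.
Proof. by move=> t0; rewrite /sinc_bump gtr0_norm. Qed.

Lemma norm_sinc_bump_le t : `|sinc_bump t| <= `|t| `^ (2 - b).
Proof.
wlog t0 : t / 0 < t => [H|].
  have [t0|t0|<-] := ltgtP 0 t; first exact: H.
    by rewrite -sinc_bumpN -[in leRHS]normrN; apply: H; rewrite oppr_gt0.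
  rewrite /sinc_bump normr0 powR0 ?mul0r ?normr0//.
  by rewrite gt_eqF// subr_gt0; have := b1; lra.
by rewrite sinc_bump_gt0// (le_trans (norm_sinc_weight_le1 _ _ t0))// gtr0_norm.
Qed.

Lemma norm_sinc_bump_leV t : t != 0 -> `|sinc_bump t| <= 8 * `|t| `^ (- b - 1).
Proof.
wlog t0 : t / 0 < t => [H|_].
  move=> tn0; have [t0|t0|e] := ltgtP 0 t; first exact: H.
    by rewrite -sinc_bumpN -[in leRHS]normrN; apply: H; rewrite ?oppr_gt0 ?oppr_eq0.
  by rewrite -e eqxx in tn0.
by rewrite sinc_bump_gt0// (le_trans (norm_sinc_weight_leV _ _ t0))// gtr0_norm.
Qed.

Lemma measurable_sinc_bump : measurable_fun setT sinc_bump.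
Proof.
rewrite /sinc_bump.
have -> : (fun t => `|t| `^ (2 - b) * (sin (t / 2) / (t / 2)) ^+ q.+3) =
   (fun t => `|t| `^ (2 - b) * (sin (t / 2) * (2 * t^-1)) ^+ q.+3).
  by apply/funext => t; rewrite invf_div.
apply: measurable_funM.
  by apply: (@measurableT_comp _ _ _ _ _ _ (fun y : R => y `^ (2 - b))); [exact: measurable_powR|exact: normr_measurable].
apply: (@measurableT_comp _ _ _ _ _ _ (fun y : R => y ^+ q.+3)); first exact: exprn_measurable.
apply: measurable_funM.
  apply: (@measurableT_comp _ _ _ _ _ _ (@sin R)); last exact: measurable_funM.
  by apply: continuous_measurable_fun; exact: continuous_sin.
by apply: measurable_funM => //; exact: measurable_invr.
Qed.

Definition pair_term (t : R) (l : nat) : R := fterm q.+2 (2 - b) t l%:Z + fterm q.+2 (2 - b) t (- l%:Z - 1).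

Lemma norm_pair_term0 t : - pi <= t <= pi -> `|pair_term t 0| <= pi `^ (2 - b) + 8.
Proof.
move=> /andP[t1 t2]; have p2 := @pi_ge2 R.
rewrite /pair_term (le_trans (ler_normD _ _))// lerD//.
  rewrite ftermE mulr0 mul0r addr0 (le_trans (norm_sinc_bump_le _))//.
  rewrite ge0_ler_powR ?nnegrE//; [by rewrite subr_ge0; have := b1; lra|by lra|by rewrite ler_norml t1].
rewrite ftermE; set y := t + _.
have ye : y = t - 2 * pi by rewrite /y oppr0 sub0r mulrN1z; ring.
have y2 : y <= - pi by rewrite ye; lra.
have y0 : y != 0 by rewrite lt_eqF//; lra.
rewrite (le_trans (norm_sinc_bump_leV y0))// ler_piMr//.
rewrite -[leRHS](powRr0 `|y|); apply: ler_powR; last by have := b0; lra.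
by rewrite ler0_norm; lra.
Qed.

(** On one period both translates have modulus at least l + 2, so each term is at most 8
    (l+2)^(-b-1); [powRN_sub_ge] puts the sum of the two in telescoping form. *)
Lemma norm_pair_termS t l : - pi <= t <= pi ->
  `|pair_term t l.+1| <= 16 / b * (l.+1%:R `^ (- b) - l.+2%:R `^ (- b)).
Proof.
move=> /andP[t1 t2]; have p2 := @pi_ge2 R.
have H y : l.+2%:R <= `|y| -> `|sinc_bump y| <= 8 * l.+2%:R `^ (- b - 1).
  move=> ly; have y0 : y != 0 by rewrite -normr_gt0 (lt_le_trans _ ly).
  rewrite (le_trans (norm_sinc_bump_leV y0))// ler_pM2l//.
  rewrite -!opprD !powRN lef_pV2 ?posrE ?powR_gt0 ?normr_gt0//.
  by rewrite ge0_ler_powR ?nnegrE//; have := b0; lra.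
have lp : l.+1%:R * 2 <= l.+1%:R * pi :> R by rewrite ler_pM2l.
have l0 : 0 <= l%:R :> R by [].
have El : l.+2%:R = l%:R + 2 :> R by rewrite -addn2 natrD.
have El1 : l.+1%:R = l%:R + 1 :> R by rewrite -addn1 natrD.
rewrite /pair_term !ftermE (le_trans (ler_normD _ _))//.
rewrite (@le_trans _ _ (16 * l.+2%:R `^ (- b - 1)))//.
  rewrite (_ : 16 * _ = 8 * l.+2%:R `^ (- b - 1) + 8 * l.+2%:R `^ (- b - 1)); last by ring.
  rewrite lerD// H//.
    rewrite (_ : l.+1%:Z%:~R = l.+1%:R)// ger0_norm; nra.
  rewrite (_ : (- l.+1%:Z - 1)%:~R = - l.+2%:R :> R); last by rewrite rmorphB rmorphN /= -[l.+2%:R]natr1 opprD.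
  rewrite ler0_norm; nra.
have := @powRN_sub_ge b l.+1%:R b0 (ltr0Sn _ _); rewrite natr1 => h.
rewrite -mulrA ler_pM2l// mulrC ler_pdivlMr//; rewrite mulrC; exact: h.
Qed.

End periodization.

(** * Unfolding the integral over one period to the line *)

Section unfolding.
Context {R : realType}.
Local Notation mu := (@lebesgue_measure R).
Local Notation Rintegrable D f := (mu.-integrable D (EFin \o f)).
Variables (b : R) (q : nat).
Hypothesis b01 : 0 < b < 1.

Let b0 : 0 < b. Proof. by case/andP: b01. Qed.

Let M := pi `^ (2 - b) + 8 + 16 / b.

(** Telescoping makes the bound independent of [N] and [t]. It yields both absolute convergence and
    a constant majorant for the partial sums. *)
Lemma sum_norm_pair_term t N : - pi <= t <= pi ->
  \sum_(0 <= l < N) `|pair_term b q t l| <= M.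
Proof.
move=> tp; have b16 : 0 <= 16 / b by rewrite divr_ge0// ltW.
have M0 : 0 <= pi `^ (2 - b) + 8 by rewrite addr_ge0 ?powR_ge0.
case: N => [|N]; first by rewrite big_nil addr_ge0.
rewrite big_nat_recl// lerD ?norm_pair_term0//.
have H : \sum_(0 <= l < N) `|pair_term b q t l.+1| <= 16 / b * (1 - N.+1%:R `^ (- b)).
  elim: N => [|N IH]; first by rewrite big_nil powR1 subrr mulr0.
  rewrite big_nat_recr//= (le_trans (lerD IH (norm_pair_termS b01 _ _ tp)))//.
  by rewrite -mulrDr addrA subrK.
by rewrite (le_trans H)// ler_piMr// gerBl powR_ge0.
Qed.

Lemma cvg_pair_term t : - pi <= t <= pi -> cvgn (series (pair_term b q t)).
Proof.
move=> tp; apply: normed_cvg; apply: nondecreasing_is_cvgn.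
  by apply/nondecreasing_seqP => n; rewrite /normed_series_of /series /= big_nat_recr//= lerDl.
by exists M => _ [n _ <-]; exact: sum_norm_pair_term.
Qed.

Lemma measurable_pair_term l : measurable_fun setT (fun t => pair_term b q t l).
Proof.
have H (c : R) : measurable_fun setT (fun t : R => sinc_bump b q (t + c)).
  by apply: (measurableT_comp (measurable_sinc_bump b q)); exact: measurable_funD.
have -> : (fun t : R => pair_term b q t l) = (fun t => sinc_bump b q (t + 2 * l%:Z%:~R * pi) + sinc_bump b q (t + 2 * (- l%:Z - 1)%:~R * pi)).
  by apply/funext => t; rewrite /pair_term !ftermE.
by apply: measurable_funD; exact: H.
Qed.

Variable c : R -> R.
Hypothesis mc : measurable_fun setT c.
Hypothesis c1 : forall t, `|c t| <= 1.
Hypothesis cper : forall t (l : int), c (t + 2 * l%:~R * pi) = c t.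

Let G t := sinc_bump b q t * c t.

Lemma cvg_integral_pair_term :
  \int[mu]_(t in `[- pi, pi]) ((\sum_(0 <= l < N) pair_term b q t l) * c t) @[N --> \oo] -->
  \int[mu]_(t in `[- pi, pi]) (fpa q.+2 (2 - b) t * c t).
Proof.
apply: (@cvg_Rintegral_dominated _ _ (fun N t => (\sum_(0 <= l < N) pair_term b q t l) * c t) _ (fun=> M)) => //.
- move=> N; apply: measurable_funTS; apply: measurable_funM => //.
  by apply: measurable_sum => l; exact: measurable_pair_term.
- move=> t /=; rewrite in_itv/= => tp; apply: cvgMl.
  exact: (cvg_pair_term tp).
- move=> N t /=; rewrite in_itv/= => tp; rewrite normrM (le_trans _ (sum_norm_pair_term N tp))//.
  by rewrite (@le_trans _ _ `|\sum_(0 <= l < N) pair_term b q t l|) ?ler_piMr// ler_norm_sum.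
- by apply: Rintegrable_itvcc => t; exact: cvg_cst.
Qed.

Let mG : measurable_fun setT G.
Proof. by apply: measurable_funM => //; exact: measurable_sinc_bump. Qed.

Lemma integrable_half_bump : Rintegrable `]0, +oo[ G /\ Rintegrable `]0, +oo[ (fun t => G (- t)).
Proof.
split.
  apply: (@eq_integrable _ _ _ mu _ _ (EFin \o (fun t => sinc_weight b q t * c t))) => //.
    by move=> t; rewrite inE/= in_itv/= andbT => t0; rewrite /G sinc_bump_gt0.
  exact: sinc_weight_mul_integrable.
apply: (@eq_integrable _ _ _ mu _ _ (EFin \o (fun t => sinc_weight b q t * c (- t)))) => //.
  by move=> t; rewrite inE/= in_itv/= andbT => t0; rewrite /G sinc_bumpN sinc_bump_gt0.
apply: sinc_weight_mul_integrable => //.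
by apply: (measurableT_comp mc); exact: oppr_measurable.
Qed.

Lemma integrable_bump : Rintegrable setT G.
Proof. by have [I1 I2] := integrable_half_bump; have [] := Rintegral_symT mG I1 I2. Qed.

Lemma integral_bump : \int[mu]_t G t = \int[mu]_(t in `]0, +oo[) (sinc_weight b q t * (c t + c (- t))).
Proof.
have [I1 I2] := integrable_half_bump; have [_ ->] := Rintegral_symT mG I1 I2.
apply: eq_Rintegral => t; rewrite inE/= in_itv/= andbT => t0.
by rewrite /G sinc_bumpN sinc_bump_gt0// mulrDr.
Qed.

(** With a primitive, the integrals over adjacent periods add up by telescoping instead of by unions
    of intervals. *)
Let P x := \int[mu]_(t in `]-oo, x]) G t.

Lemma integral_bump_itv x y : x <= y -> \int[mu]_(t in `[x, y]) G t = P y - P x.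
Proof.
move=> xy; have I : Rintegrable `]-oo, y] G by apply: (integrableS _ _ _ integrable_bump).
rewrite /P (@Rintegral_itvB _ _ -oo%O (BRight y) x)//.
by rewrite Rintegral_itv_obnd_cbnd//; apply: (integrableS _ _ _ integrable_bump).
Qed.

Lemma integral_bump_shift (l : int) :
  Rintegrable `[- pi, pi] (fun t => sinc_bump b q (t + 2 * l%:~R * pi) * c t) /\
  \int[mu]_(t in `[- pi, pi]) (sinc_bump b q (t + 2 * l%:~R * pi) * c t) =
  P ((2 * l%:~R + 1) * pi) - P ((2 * l%:~R - 1) * pi).
Proof.
have n1 : (1 : R) != 0 by [].
have I : Rintegrable `[(2 * l%:~R - 1) * pi, (2 * l%:~R + 1) * pi] G.
  by apply: (integrableS _ _ _ integrable_bump).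
have E : (fun x : R => 1 * x + 2 * l%:~R * pi) @^-1` `[(2 * l%:~R - 1) * pi, (2 * l%:~R + 1) * pi]
    = `[- pi, pi]%classic.
  by apply/seteqP; split => x /=; rewrite !in_itv/= => /andP[h1 h2]; apply/andP; split; lra.
have EG t : G (1 * t + 2 * l%:~R * pi) = sinc_bump b q (t + 2 * l%:~R * pi) * c t.
  by rewrite /G mul1r cper.
have := Rintegrable_affine (2 * l%:~R * pi) n1 (measurable_itv _) I.
have := Rintegral_affine (2 * l%:~R * pi) n1 (measurable_itv _) I.
have -> : (fun x => G (1 * x + 2 * l%:~R * pi)) = (fun t => sinc_bump b q (t + 2 * l%:~R * pi) * c t).
  exact/funext.
rewrite E normr1 mul1r integral_bump_itv; last by rewrite ler_wpM2r ?pi_ge0//; lra.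
by move=> ->.
Qed.

(** The translates - N, ..., N - 1 tile consecutive periods, and each step adds one period at either
    end. Their number is even, so the interval is centred at - pi and not at 0. *)
Lemma integral_sum_pair_term N :
  Rintegrable `[- pi, pi] (fun t => (\sum_(0 <= l < N) pair_term b q t l) * c t) /\
  \int[mu]_(t in `[- pi, pi]) ((\sum_(0 <= l < N) pair_term b q t l) * c t) =
  P ((2 * N%:R - 1) * pi) - P ((- (2 * N%:R) - 1) * pi).
Proof.
elim: N => [|N [IN EN]].
  split.
    rewrite (_ : (fun t => _) = cst 0); first exact: integrable0.
    by apply/funext => t; rewrite big_nil mul0r.
  under eq_Rintegral do rewrite big_nil mul0r.
  by rewrite Rintegral_cst// mul0r mulr0 oppr0 subrr.
pose g1 t := sinc_bump b q (t + 2 * N%:Z%:~R * pi) * c t.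
pose g2 t := sinc_bump b q (t + 2 * (- N%:Z - 1)%:~R * pi) * c t.
have [I1 E1] := integral_bump_shift N%:Z.
have [I2 E2] := integral_bump_shift (- N%:Z - 1).
have I12 : Rintegrable `[- pi, pi] (fun t => g1 t + g2 t).
  exact: (@integrableD _ _ _ mu _ _ (EFin \o g1) (EFin \o g2) I1 I2).
have E t : (\sum_(0 <= l < N.+1) pair_term b q t l) * c t =
    (\sum_(0 <= l < N) pair_term b q t l) * c t + (g1 t + g2 t).
  by rewrite big_nat_recr//= mulrDl [pair_term b q t N]/pair_term !ftermE mulrDl.
split.
  rewrite (_ : (fun t => _) = fun t => (\sum_(0 <= l < N) pair_term b q t l) * c t + (g1 t + g2 t)); last exact/funext.
  exact: (@integrableD _ _ _ mu _ _ (EFin \o _) (EFin \o _) IN I12).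
under eq_Rintegral do rewrite E.
rewrite RintegralD// RintegralD// EN E1 E2.
have -> : (N%:Z)%:~R = N%:R :> R by [].
have -> : (- N%:Z - 1)%:~R = - N%:R - 1 :> R by rewrite rmorphB rmorphN.
have -> : 2 * (- N%:R - 1) + 1 = - (2 * N%:R) - 1 :> R by ring.
have -> : 2 * (- N%:R - 1) - 1 = - (2 * N.+1%:R) - 1 :> R by rewrite -natr1; ring.
have -> : 2 * N%:R + 1 = 2 * N.+1%:R - 1 :> R by rewrite -natr1; ring.
by ring.
Qed.

(** Kept for a general bounded measurable [c] of period 2 pi, so that the cosine and the sine
    coefficients are two instances. *)
Lemma fpa_integral :
  \int[mu]_(t in `[- pi, pi]) (fpa q.+2 (2 - b) t * c t) =
  \int[mu]_(t in `]0, +oo[) (sinc_weight b q t * (c t + c (- t))).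
Proof.
rewrite -integral_bump -(cvg_lim _ cvg_integral_pair_term)//.
have p0 := @pi_gt0 R.
pose D n : set R := `](- (2 * n.+1%:R) - 1) * pi, (2 * n.+1%:R - 1) * pi]%classic.
have cv : \int[mu]_(t in D n) G t @[n --> \oo] --> \int[mu]_t G t.
  apply: cvg_Rintegral_exhaust => //; last exact: integrable_bump.
    by move=> n; exact: measurable_itv.
  move=> t _; near=> n; rewrite /D/= in_itv/=.
  have nt : `|t| <= n%:R by near: n; exact: nbhs_infty_ger.
  have p2 := @pi_ge2 R.
  have np : n%:R * 2 <= n%:R * pi :> R by rewrite ler_wpM2l.
  have n0 : 0 <= n%:R :> R by [].
  move: nt; rewrite ler_norml => /andP[h1 h2]; rewrite -natr1; apply/andP; split; lra.
apply/cvg_lim => //; rewrite -cvg_shiftS.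
rewrite (_ : (fun n => _) = fun n => \int[mu]_(t in D n) G t)//.
apply/funext => n; have [_ ->] := integral_sum_pair_term n.+1.
rewrite /P /D (@Rintegral_itvB _ _ -oo%O (BRight ((2 * n.+1%:R - 1) * pi)))//.
  by apply: (integrableS _ _ _ integrable_bump).
rewrite bnd_simp ler_wpM2r ?(ltW p0)//.
have : 0 <= n.+1%:R :> R by [].
lra.
Unshelve. all: by end_near. Qed.

End unfolding.

(** * Comparison of the coefficients *)

Section coefficients.
Context {R : realType}.
Local Notation mu := (@lebesgue_measure R).
Local Notation Rintegrable D f := (mu.-integrable D (EFin \o f)).
Variables (b : R) (q : nat).
Hypothesis b01 : 0 < b < 1.

Let b0 : 0 < b. Proof. by case/andP: b01. Qed.
Let b1 : b < 1. Proof. by case/andP: b01. Qed.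

Lemma tcoefE (k : int) : tcoef q.+2 (2 - b) k =
  pi^-1 * \int[mu]_(t in `]0, +oo[) (sinc_weight b q t * cos (k%:~R * t)).
Proof.
have E : 2%:R - (2 - b) = b by ring.
rewrite /tcoef /RL_left /RL_right !E derive2_left// derive2_right// /= expr2 mulrNN mul1r mul1r.
set x : R := q.+3%:R / 2 - k%:~R.
rewrite -mulrDl fracderiv_sym.
have T : sinc_transform b q x = \int[mu]_(t in `]0, +oo[) (sinc_weight b q t * cos (k%:~R * t)).
  apply: eq_Rintegral => t _; congr (_ * _).
  by rewrite /x addrAC subrr add0r mulrN cosN mulrC.
rewrite -T -[X in _ = _ * X]opprK -sinc_transformE//.
have := Gamma_sine_moment b01; rewrite Gamma_succ//.
(* The prefactor thus has the denominator - 2 cos (pi b/2), whose sign matches the one in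
   [sinc_transformE]. *)
have -> : pi * (2 - b) / 2 = - (pi * b / 2) + pi :> R by field.
rewrite cosDpi cosN; have p0 := @pi_gt0 R.
have c0 : 0 < cos (pi * b / 2) by apply: cos_gt0_pihalf; have := b0; have := b1; nra.
set C := cos _ in c0 *; set I := iter _ _ _ _; set K := sine_moment b; set g := Gamma b => gK.
have pi0 : pi != 0 :> R by rewrite gt_eqF.
(* Nonvanishing of [Gamma b] follows from [gK], whose right-hand side is nonzero. *)
have gn0 : g != 0.
  apply/eqP => g0; move: gK; rewrite g0 mulr0 mul0r => /esym/eqP.
  by rewrite mulf_eq0 invr_eq0 mulf_eq0 (negbTE pi0) (gt_eqF c0) pnatr_eq0.
have -> : K = pi / (2 * C) / (b * g).
  by rewrite -gK mulrAC mulfV ?mul1r// mulf_neq0// gt_eqF.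
have bn0 : b != 0 by rewrite gt_eqF.
have Cn0 : C != 0 by rewrite gt_eqF.
clearbody C; move: (pi : R) pi0 => P P0.
by field; rewrite bn0 Cn0 P0 gn0.
Qed.

Lemma cos_periodZ (x : R) (m : int) : cos (x + m%:~R * (2 * pi)) = cos x.
Proof.
have H (y : R) (n : nat) : cos (y + n%:R * (2 * pi)) = cos y.
  have := periodicn (@cosD2pi R) n y.
  by rewrite !mulr_natl.
case: m => n; first exact: H.
by rewrite NegzE rmorphN mulNr -(H (x - _) n.+1) subrK.
Qed.

Lemma sin_periodZ (x : R) (m : int) : sin (x + m%:~R * (2 * pi)) = sin x.
Proof.
rewrite -!cosBpihalf.
by rewrite addrAC cos_periodZ.
Qed.

(** After folding the line at 0 the cosine doubles, which reduces 1/(2 pi) to 1/pi, and the sine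
    cancels, so the coefficient is real. *)
Lemma fourier_coefE (k : int) :
  fourier_coef (fpa q.+2 (2 - b)) k = Complex (tcoef q.+2 (2 - b) k) 0.
Proof.
have per (t : R) (l : int) : k%:~R * (t + 2 * l%:~R * pi) = k%:~R * t + (k * l)%:~R * (2 * pi).
  by rewrite intrM; ring.
have mk : measurable_fun setT (fun t : R => k%:~R * t) by exact: measurable_funM.
rewrite /fourier_coef; congr Complex.
- rewrite (@fpa_integral _ _ _ b01 (fun t => cos (k%:~R * t))); last 3 first.
  + by apply: (measurableT_comp _ mk); apply: continuous_measurable_fun; exact: continuous_cos.
  + by move=> t; exact: cos_max.
  + by move=> t l; rewrite per cos_periodZ.
  rewrite tcoefE.
  have I : Rintegrable `]0, +oo[ (fun t => sinc_weight b q t * cos (k%:~R * t)).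
    apply: sinc_weight_mul_integrable => //; last by move=> t; exact: cos_max.
    by apply: (measurableT_comp _ mk); apply: continuous_measurable_fun; exact: continuous_cos.
  have E t : sinc_weight b q t * (cos (k%:~R * t) + cos (k%:~R * - t)) =
     2 * (sinc_weight b q t * cos (k%:~R * t)).
    by rewrite mulrN cosN; ring.
  under eq_Rintegral do rewrite E.
  rewrite RintegralZl// mulrA; congr (_ * _).
  by rewrite invfM mulrAC mulVf ?mul1r.
- rewrite (@fpa_integral _ _ _ b01 (fun t => sin (k%:~R * t))); last 3 first.
  + by apply: (measurableT_comp _ mk); apply: continuous_measurable_fun; exact: continuous_sin.
  + by move=> t; exact: sin_max.
  + by move=> t l; rewrite per sin_periodZ.
  have E t : sinc_weight b q t * (sin (k%:~R * t) + sin (k%:~R * - t)) = 0.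
    by rewrite mulrN sinN subrr mulr0.
  under eq_Rintegral do rewrite E.
  by rewrite Rintegral_cst// mul0r mulr0 oppr0.
Qed.

End coefficients.

Theorem theorem5p1 (R : realType) (alpha : R) (p n : nat) :
  1 < alpha < 2 -> (2 <= p)%N -> (1 <= n)%N ->
  map_mx (fun x : R => Complex x 0) (Tnpa n p alpha)
    = toeplitz (n + p - 2) (fpa p alpha) /\
  (forall k : int, fourier_coef (fpa p alpha) k = Complex (tcoef p alpha k) 0).
Proof.
move=> /andP[a1 a2] p2 _.
have H k : fourier_coef (fpa p alpha) k = Complex (tcoef p alpha k) 0.
  have b01 : 0 < 2 - alpha < 1 by apply/andP; split; lra.
  have := fourier_coefE (p - 2) b01 k.
  by rewrite subKr -addn2 subnK.
by split => //; apply/matrixP => i j; rewrite !mxE H.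
Qed.
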